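(* Each of the following two decision problems is solvable in linear time. (i) Input: a finite graph $G$ and a connected subgraph $H$ of $G$. Question: is $H$ an $S$-Eulerian subgraph of $G$? (ii) Input: a finite graph $G$ and a connected subgraph $H$ of $G$. Question: is $H$ a semi $S$-Eulerian subgraph of $G$?
   Context: Graphs are undirected. A trail is a walk in which no edge is repeated; it is closed if its first and last vertices coincide, and open if they are different. A finite graph is Eulerian if it has a closed trail that contains all of its edges and visits all of its vertices (the one-vertex graph is Eulerian, via the trivial trail); it is semi-Eulerian if it has an open trail that contains all of its edges and visits all of its vertices. A subgraph $H$ of a finite graph $G$ is called $S$-Eulerian (respectively semi $S$-Eulerian) if there exists an Eulerian (respectively semi-Eulerian) graph $H'$ with $H\subseteq H'\subseteq G$ (subgraph containment, so both the vertices and the edges of $H$ belong to $H'$). Here ''$S$-Eulerian'' is just the name of the notion; $S$ is not a parameter. Linear time means time $O(|V(G)|+|E(G)|)$ in the usual sense for graph algorithms (graphs given by adjacency lists, with the vertices and edges of $H$ marked, on a unit-cost random access machine). *)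

(* Defs.v *)
From mathcomp Require Import all_boot.

Set Implicit Arguments.
Unset Strict Implicit.
Unset Printing Implicit Defensive.

(* Loops and parallel edges are allowed. The pair [ends e] carries no
   orientation: every notion below treats its two components symmetrically. *)
Record graph := Graph {
  nv : nat;
  ne : nat;
  ends : 'I_ne -> 'I_nv * 'I_nv }.

Record subgraph (G : graph) := Subgraph {
  sV : {set 'I_(nv G)};
  sE : {set 'I_(ne G)};
  sE_ends : forall e, e \in sE ->
    ((ends e).1 \in sV) && ((ends e).2 \in sV) }.

Definition contained (G : graph) (H K : subgraph G) : Prop :=
  (sV H \subset sV K) /\ (sE H \subset sE K).

(* A dart is an edge with a direction of traversal; a loop has two darts. *)
Definition dart (G : graph) : finType := ('I_(ne G) * bool)%type.

Definition src (G : graph) (d : dart G) : 'I_(nv G) :=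
  if d.2 then (ends d.1).2 else (ends d.1).1.

Definition dst (G : graph) (d : dart G) : 'I_(nv G) :=
  if d.2 then (ends d.1).1 else (ends d.1).2.

Fixpoint is_walk (G : graph) (x : 'I_(nv G)) (p : seq (dart G)) : bool :=
  if p is d :: p' then (src d == x) && is_walk (dst d) p' else true.

Definition walk_edges (G : graph) (p : seq (dart G)) : seq 'I_(ne G) :=
  [seq d.1 | d <- p].

Definition walk_vertices (G : graph) (x : 'I_(nv G)) (p : seq (dart G)) :
  seq 'I_(nv G) := x :: [seq dst d | d <- p].

Definition walk_end (G : graph) (x : 'I_(nv G)) (p : seq (dart G)) :
  'I_(nv G) := last x [seq dst d | d <- p].

Definition walk_in (G : graph) (K : subgraph G) (x : 'I_(nv G))
    (p : seq (dart G)) : Prop :=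
  [/\ x \in sV K, {subset walk_edges p <= sE K} & is_walk x p].

Definition trail_in (G : graph) (K : subgraph G) (x : 'I_(nv G))
    (p : seq (dart G)) : Prop :=
  walk_in K x p /\ uniq (walk_edges p).

Definition covers (G : graph) (K : subgraph G) (x : 'I_(nv G))
    (p : seq (dart G)) : Prop :=
  {subset sE K <= walk_edges p} /\ {subset sV K <= walk_vertices x p}.

Definition Eulerian (G : graph) (K : subgraph G) : Prop :=
  exists x p, [/\ trail_in K x p, walk_end x p = x & covers K x p].

Definition semi_Eulerian (G : graph) (K : subgraph G) : Prop :=
  exists x p, [/\ trail_in K x p, walk_end x p <> x & covers K x p].

Definition S_Eulerian (G : graph) (H : subgraph G) : Prop :=
  exists K : subgraph G, contained H K /\ Eulerian K.

Definition semi_S_Eulerian (G : graph) (H : subgraph G) : Prop :=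
  exists K : subgraph G, contained H K /\ semi_Eulerian K.

(* The graph without vertices does not count as connected. *)
Definition connected (G : graph) (H : subgraph G) : Prop :=
  (exists x, x \in sV H) /\
  (forall x y, x \in sV H -> y \in sV H ->
     exists p, walk_in H x p /\ walk_end x p = y).

(* [adj v] lists, in an arbitrary order, one entry for each edge incident with
   [v] (two for a loop): the other end, and whether the edge belongs to [H]. *)
Definition adjacency_lists (G : graph) (H : subgraph G)
    (adj : 'I_(nv G) -> seq ('I_(nv G) * bool)) : Prop :=
  forall v, perm_eq (adj v)
    [seq (dst d, d.1 \in sE H) | d <- enum (dart G) & src d == v].

(* The number of vertices, and then for each vertex in turn: its mark, the
   length of its list, and the entries of its list, each as a neighbour
   followed by a mark. The total length is 1 + 2|V(G)| + 4|E(G)|. *)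
Definition input_words (G : graph) (H : subgraph G)
    (adj : 'I_(nv G) -> seq ('I_(nv G) * bool)) : seq nat :=
  nv G :: flatten
    [seq [:: nat_of_bool (v \in sV H), size (adj v)
           & flatten [seq [:: nat_of_ord a.1; nat_of_bool a.2] | a <- adj v]]
    | v <- enum 'I_(nv G)].

(* Random access machine. A program mentions finitely many registers; the
   memory is addressed only indirectly, through the contents of a register.
   Words are natural numbers, and there is no multiplication. *)
Inductive instr :=
| Const (r k : nat)    (* R[r] := k *)
| Copy (r a : nat)     (* R[r] := R[a] *)
| Add (r a b : nat)    (* R[r] := R[a] + R[b] *)
| Sub (r a b : nat)    (* R[r] := R[a] - R[b], truncated at 0 *)
| Read (r a : nat)     (* R[r] := M[R[a]] *)
| Write (a r : nat)    (* M[R[a]] := R[r] *)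
| Jump (l : nat)
| Jzero (a l : nat)    (* go to l if R[a] = 0 *)
| Halt (b : bool).     (* stop, with answer b *)

Definition program := seq instr.

Record state := State {
  pc : nat;
  reg : nat -> nat;
  mem : nat -> nat }.

Definition upd (f : nat -> nat) (i x : nat) : nat -> nat :=
  fun j => if j == i then x else f j.

Definition exec (i : instr) (s : state) : state :=
  let: State l R M := s in
  match i with
  | Const r k => State l.+1 (upd R r k) M
  | Copy r a => State l.+1 (upd R r (R a)) M
  | Add r a b => State l.+1 (upd R r (R a + R b)) M
  | Sub r a b => State l.+1 (upd R r (R a - R b)) M
  | Read r a => State l.+1 (upd R r (M (R a))) M
  | Write a r => State l.+1 R (upd M (R a) (R r))
  | Jump l' => State l' R M
  | Jzero a l' => State (if R a == 0 then l' else l.+1) R M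
  | Halt _ => s
  end.

(* [run P t s = Some b] iff [P], started in [s], stops with answer [b] after
   executing at most [t] instructions; a program counter outside of [P] never
   yields an answer. *)
Fixpoint run (P : program) (t : nat) (s : state) : option bool :=
  if t is t'.+1 then
    if onth P (pc s) is Some i then
      if i is Halt b then Some b else run P t' (exec i s)
    else None
  else None.

Definition init (w : seq nat) : state :=
  State 0 (fun=> 0) (fun i => nth 0 w i).

(* Linear time for a promise problem on pairs (G, H): nothing is required of
   the program outside of the promise [A]. *)
Definition solvable_in_linear_time
    (A Q : forall G : graph, subgraph G -> Prop) : Prop :=
  exists (P : program) (c : nat),
  forall (G : graph) (H : subgraph G) (adj : 'I_(nv G) -> seq ('I_(nv G) * bool)),
    A G H -> adjacency_lists H adj ->
    exists b : bool,
      run P (c * (nv G + ne G)) (init (input_words H adj)) = Some b /\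
      (b <-> Q G H).

(* Main.v *)
Require Import Defs.
From mathcomp Require Import all_boot zify.

Set Implicit Arguments.
Unset Strict Implicit.
Unset Printing Implicit Defensive.

(* Call a component of [G - E(H)] odd if it contains an odd number of vertices
   of odd degree in [H]. A set of edges outside of [H] that repairs the degrees
   of [H] is a T-join in [G - E(H)], so [H] is S-Eulerian iff there is no odd
   component. For an open trail from [x] to [y] the odd components must be
   those separating [x] from [y]: either there are exactly two, and any choice
   of one vertex in each works, or there is none, and one needs an edge
   outside of [H], not a loop, that meets [H]. Disconnected pieces of a T-join
   are harmless: only the component containing [H] is kept.

   All of this is decided by one breadth first search of [G - E(H)]. The
   degree parity of a component is the parity of the number of marked list
   entries read while searching it, and the search is a single loop, each
   round of which reads one list entry, takes up one vertex of the queue or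
   tries one new root. *)

(** * Trails and T-joins *)

Section Parity.
Variable G : graph.
Implicit Types (F J : {set 'I_(ne G)}) (d : dart G) (p : seq (dart G))
  (x y z u v w : 'I_(nv G)) (K H : subgraph G).

Definition flip d : dart G := (d.1, ~~ d.2).

Lemma src_flip d : src (flip d) = dst d.
Proof. by case: d => e []. Qed.

Lemma dst_flip d : dst (flip d) = src d.
Proof. by case: d => e []. Qed.

Lemma same_edge d d' : d.1 = d'.1 -> d = d' \/ d = flip d'.
Proof. by case: d d' => [e []] [e' []] /= ->; [left|right|right|left]. Qed.

(** A loop counts twice in a degree, hence for nothing here; this makes [parity F v] the degree of
    [v] in [F] modulo 2. *)
Definition ends_parity v (e : 'I_(ne G)) : bool :=
  ((ends e).1 == v) (+) ((ends e).2 == v).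

Definition parity F v : bool := \big[addb/false]_(e in F) ends_parity v e.

Lemma ends_parity_dart v d : ends_parity v d.1 = (v == src d) (+) (v == dst d).
Proof.
by rewrite /ends_parity /src /dst !(eq_sym v); case: d => e [] //=; rewrite addbC.
Qed.

Definition symdiff F1 F2 := [set e | (e \in F1) (+) (e \in F2)].

Lemma parity_symdiff F1 F2 v :
  parity (symdiff F1 F2) v = parity F1 v (+) parity F2 v.
Proof.
rewrite /parity !(big_mkcond (fun e => e \in _)) -big_split /=.
apply: eq_bigr => e _; rewrite inE.
by case: (e \in F1); case: (e \in F2); case: (ends_parity v e).
Qed.

Lemma parityU F1 F2 v : [disjoint F1 & F2] ->
  parity (F1 :|: F2) v = parity F1 v (+) parity F2 v.
Proof.
move=> dis; rewrite -parity_symdiff; congr parity; apply/setP => e; rewrite !inE.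
by case: (boolP (e \in F1)) => // /(disjointFr dis) ->.
Qed.

Lemma parityD1 F v d : d.1 \in F ->
  parity F v = ((v == src d) (+) (v == dst d)) (+) parity (F :\ d.1) v.
Proof. by move=> dF; rewrite /parity (big_setD1 d.1) //= ends_parity_dart. Qed.

Lemma sum_pred1 (C : {pred 'I_(nv G)}) x :
  \big[addb/false]_(v in C) (v == x) = (x \in C).
Proof.
case: (boolP (x \in C)) => xC.
  by rewrite (bigD1 x) //= eqxx big1 // => v /andP[_ /negbTE].
by rewrite big1 // => v vC; apply/eqP => vx; rewrite -vx vC in xC.
Qed.

(* Each edge of [F] is counted twice or not at all. *)
Lemma sum_parity F (C : {pred 'I_(nv G)}) :
  (forall d, d.1 \in F -> (src d \in C) = (dst d \in C)) ->
  \big[addb/false]_(v in C) parity F v = false.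
Proof.
move=> closedC; rewrite /parity exchange_big big1 // => e eF.
have /= := closedC (e, false) eF; rewrite /src /dst /= => closed_e.
transitivity (((ends e).1 \in C) (+) ((ends e).2 \in C)); last by rewrite closed_e addbb.
rewrite -!sum_pred1 -big_split; apply: eq_bigr => v _.
by rewrite /ends_parity !(eq_sym v).
Qed.

(** * Walks, and trails obtained from degree parities *)

Lemma is_walk_cat x p1 p2 :
  is_walk x (p1 ++ p2) = is_walk x p1 && is_walk (walk_end x p1) p2.
Proof. by elim: p1 x => //= d p IH x; rewrite IH andbA. Qed.

Lemma walk_end_cat x p1 p2 :
  walk_end x (p1 ++ p2) = walk_end (walk_end x p1) p2.
Proof. by rewrite /walk_end map_cat last_cat. Qed.

Lemma walk_vertices_split x p z : z \in walk_vertices x p ->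
  exists p1 p2, p = p1 ++ p2 /\ walk_end x p1 = z.
Proof.
elim: p x => [|d p IH] x; first by rewrite inE => /eqP ->; exists [::], [::].
rewrite /walk_vertices inE => /predU1P[->|]; first by exists [::], (d :: p).
by case/IH => p1 [p2 [-> <-]]; exists (d :: p1), p2.
Qed.

Lemma dart_of_walk x p d : is_walk x p -> d \in p ->
  src d \in walk_vertices x p /\ dst d \in walk_vertices x p.
Proof.
elim: p x => //= d' p IH x /andP[/eqP <- wp]; rewrite inE => /predU1P[->|dp].
  by rewrite !inE !eqxx orbT.
by have [h1 h2] := IH _ wp dp; split; rewrite inE; apply/orP; right.
Qed.

Lemma edge_of_walk x p d : is_walk x p -> d.1 \in walk_edges p ->
  src d \in walk_vertices x p /\ dst d \in walk_vertices x p.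
Proof.
move=> wp /mapP[d' d'p /same_edge[->|->]]; have [] := dart_of_walk wp d'p => //.
by rewrite src_flip dst_flip.
Qed.

Lemma parity_walk x p v : is_walk x p -> uniq (walk_edges p) ->
  parity [set e in walk_edges p] v = (v == x) (+) (v == walk_end x p).
Proof.
move=> wp up; rewrite /parity.
have -> : \big[addb/false]_(e in [set e in walk_edges p]) ends_parity v e
    = \big[addb/false]_(e <- walk_edges p) ends_parity v e.
  by rewrite big_uniq //; apply: eq_bigl => e; rewrite inE.
elim: p x wp {up} => [|d p IH] x /=; first by rewrite big_nil addbb.
case/andP=> /eqP <- wp; rewrite big_cons (IH _ wp) ends_parity_dart.
by rewrite -addbA (addbA (v == dst d)) addbb.
Qed.

(** Greedy: leaving [x] along an edge and deleting that edge moves the parity defect to the other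
    end, and having no edge left at [x] forces [x = y]. The last clause makes the trail nonempty, as
    the splicing in [covering_trail] requires. *)
Lemma trail_of_parity F x y :
  (forall v, parity F v = (v == x) (+) (v == y)) ->
  exists p, [/\ is_walk x p, uniq (walk_edges p), {subset walk_edges p <= F},
    walk_end x p = y & forall d, d.1 \in F -> src d = x -> p <> [::]].
Proof.
elim: {F}#|F| {-2}F (erefl #|F|) x => [|n IH] F cardF x parF.
  have F0 : F = set0 by apply/eqP; rewrite -cards_eq0 cardF.
  have /eqP : x = y.
    by have := parF x; rewrite F0 /parity big_set0 eqxx; case: eqP.
  by exists [::]; split=> //=; [apply/eqP | move=> d; rewrite F0 inE].
case: (boolP [exists d : dart G, (d.1 \in F) && (src d == x)]) => [|nodart].
  case/existsP=> d /andP[dF /eqP sd].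
  have cardF' : #|F :\ d.1| = n by move: cardF; rewrite (cardsD1 d.1) dF => -[].
  have [|p [wp up pF endp _]] := IH _ cardF' (dst d).
    move=> v; have := parF v; rewrite (parityD1 v dF) sd.
    by case: (v == x); case: (v == dst d); case: (v == y); case: (parity _ v).
  exists (d :: p); split=> //=.
  - by rewrite sd eqxx.
  - by rewrite up andbT; apply/negP => /pF; rewrite !inE eqxx.
  - by move=> e; rewrite inE => /predU1P[->|/pF]; rewrite // !inE => /andP[].
exists [::]; split=> //=.
  have := parF x; rewrite eqxx /parity big1; first by case: eqP.
  move=> e eF; apply/negbTE/negP; rewrite (ends_parity_dart x (e, false)) => he.
  case/negP: nodart; apply/existsP.
  case: (x =P src (e, false)) he => [->|_] he; first by exists (e, false); rewrite /= eF eqxx.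
  by exists (e, true); rewrite /= eF eq_sym.
move=> d dF sd; case/negP: nodart; apply/existsP; exists d.
by rewrite dF sd eqxx.
Qed.

(** A walk of [K] that starts on the trail never leaves its vertices: each edge it takes is used by
    the trail, which therefore visits both ends. *)
Lemma exhausted_trail K x p : connected K -> trail_in K x p ->
  (forall d, d.1 \in sE K -> src d \in walk_vertices x p -> d.1 \in walk_edges p) ->
  covers K x p.
Proof.
move=> [_ conK] [[xK pK wp] up] ex.
have visited v : v \in sV K -> v \in walk_vertices x p.
  move=> vK; have [q [[_ qK wq] endq]] := conK x v xK vK.
  have : x \in walk_vertices x p by rewrite inE eqxx.
  rewrite -endq; move: {1 2 4}x wq; elim: q qK {endq} => //= d q IH qK z.
  case/andP=> /eqP <- wq zp; apply: (IH _ (dst d)) => //.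
    by move=> e eq; apply: qK; rewrite inE eq orbT.
  have dK : d.1 \in sE K by apply: qK; rewrite inE eqxx.
  by have [] := edge_of_walk wp (ex d dK zp).
split=> [e eK|]; last exact: visited.
by apply: (ex (e, false)) => //; apply: visited; case/andP: (sE_ends eK).
Qed.

(* Hierholzer: as long as an unused edge meets the trail, the unused edges form
   an even graph, in which a closed trail can be found and spliced in. *)
Lemma covering_trail K x y : connected K -> x \in sV K ->
  (forall v, parity (sE K) v = (v == x) (+) (v == y)) ->
  exists p, [/\ trail_in K x p, walk_end x p = y & covers K x p].
Proof.
move=> conK xK parK.
suff ext n p : #|sE K :\: [set e in walk_edges p]| < n ->
    trail_in K x p -> walk_end x p = y ->
    exists p', [/\ trail_in K x p', walk_end x p' = y & covers K x p'].
  have [p [wp up pK endp _]] := trail_of_parity parK.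
  by apply: (ext _ p (leqnn _)).
elim: n p => // n IH p; set U := _ :\: _ => cardU trp endp.
have [[_ pK wp] up] := trp.
case: (boolP [exists d : dart G, (d.1 \in U) && (src d \in walk_vertices x p)]).
  case/existsP=> d /andP[dU dp].
  (* The right side is always false; this form of it makes [trail_of_parity] return a closed trail
     at [src d]. *)
  have parU v : parity U v = (v == src d) (+) (v == src d).
    rewrite addbb; have := parK v.
    have subK : [set e in walk_edges p] \subset sE K.
      by apply/subsetP => e; rewrite inE => /pK.
    rewrite -(setID (sE K) [set e in walk_edges p]) (setIidPr subK) parityU.
      by rewrite (parity_walk _ wp up) endp -/U; case: (v == x); case: (v == y); case: (parity U v).
    by rewrite disjoints_subset; apply/subsetP => e; rewrite !inE => ->.
  have [q [wq uq qU endq qne]] := trail_of_parity parU.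
  have [p1 [p2 [defp endp1]]] := walk_vertices_split dp.
  have perm_edges : perm_eq (walk_edges (p1 ++ q ++ p2)) (walk_edges q ++ walk_edges p).
    by rewrite defp /walk_edges !map_cat perm_catCA.
  apply: (IH (p1 ++ q ++ p2)).
  - rewrite ltnS in cardU; apply: leq_trans cardU; apply: proper_card.
    rewrite properE; apply/andP; split.
      apply/subsetP=> e; rewrite !inE (perm_mem perm_edges) mem_cat negb_or.
      by case/andP=> /andP[_ ->] ->.
    have {qne}: q != [::] by apply/eqP; exact: (qne d).
    case: q {endq wq uq} qU perm_edges => // d' q qU perm_edges _.
    have d'U : d'.1 \in U by apply: qU; rewrite inE eqxx.
    by apply/subsetPn; exists d'.1; rewrite // !inE (perm_mem perm_edges) inE eqxx.
  - split; first split=> //.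
    + move=> e; rewrite (perm_mem perm_edges) mem_cat => /orP[/qU|/pK //].
      by rewrite inE => /andP[].
    + by move: wp; rewrite defp !is_walk_cat endp1 wq endq => /andP[-> ->].
    rewrite (perm_uniq perm_edges) cat_uniq uq up andbT /=.
    by apply/hasPn => e ep; apply/negP => /qU; rewrite !inE ep.
  - by move: endp; rewrite defp !walk_end_cat endp1 endq.
move=> nodart; exists p; split=> //; apply: exhausted_trail => // d dK dp.
apply: contraR nodart => dNp; apply/existsP; exists d.
by rewrite !inE dNp dK.
Qed.

(** * Components of a set of edges, and T-joins *)

Definition edge_rel F : rel 'I_(nv G) :=
  fun v w => [exists d : dart G, [&& d.1 \in F, src d == v & dst d == w]].

Lemma edge_relP F v w :
  reflect (exists d : dart G, [/\ d.1 \in F, src d = v & dst d = w]) (edge_rel F v w).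
Proof.
apply: (iffP existsP) => -[d]; first by case/and3P=> ? /eqP ? /eqP ?; exists d.
by case=> dF <- <-; exists d; rewrite dF !eqxx.
Qed.

Lemma edge_rel_sym F : symmetric (edge_rel F).
Proof.
suff imp v w : edge_rel F v w -> edge_rel F w v.
  by move=> v w; apply/idP/idP; apply: imp.
case/edge_relP=> d [dF <- <-]; apply/edge_relP; exists (flip d).
by rewrite src_flip dst_flip.
Qed.

Lemma edge_connect_sym F : connect_sym (edge_rel F).
Proof. exact/sym_connect_sym/edge_rel_sym. Qed.

Lemma connect_dart F d x : d.1 \in F ->
  connect (edge_rel F) x (src d) = connect (edge_rel F) x (dst d).
Proof.
move=> dF; apply/same_connect_r; first exact: edge_connect_sym.
by apply/connect1/edge_relP; exists d.
Qed.

Lemma connect_walk F x y : connect (edge_rel F) x y ->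
  exists p, [/\ is_walk x p, {subset walk_edges p <= F} & walk_end x p = y].
Proof.
case/connectP=> q; elim: q x => [|z q IH] x /=; first by move=> _ ->; exists [::].
case/andP=> /edge_relP[d [dF sd dd]] qz /(IH _ qz)[p [wp pF endp]].
exists (d :: p); rewrite /= sd eqxx dd; split=> //.
  by move=> e; rewrite inE => /predU1P[->|/pF].
by rewrite /walk_end /= dd.
Qed.

Lemma walk_connect F x p v : is_walk x p -> {subset walk_edges p <= F} ->
  v \in walk_vertices x p -> connect (edge_rel F) x v.
Proof.
elim: p x => [|d p IH] x /=; first by rewrite inE => _ _ /eqP ->.
case/andP=> /eqP <- wp pF; rewrite inE => /predU1P[-> //|vp].
rewrite edge_connect_sym (connect_dart _ (pF d.1 _)) ?inE ?eqxx // edge_connect_sym.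
by apply: IH => // e ep; apply: pF; rewrite inE ep orbT.
Qed.

(** A walk may repeat edges, so [J] keeps those used an odd number of times, built up by symmetric
    differences. *)
Lemma path_join F x y : connect (edge_rel F) x y ->
  exists2 J : {set _}, J \subset F & forall v, parity J v = (v == x) (+) (v == y).
Proof.
case/connect_walk=> p [wp pF <-]; elim: p x wp pF => [|d p IH] x /=.
  by exists set0; rewrite ?sub0set // => v; rewrite /parity big_set0 addbb.
case/andP=> /eqP <- wp pF; have [|J JF parJ] := IH _ wp.
  by move=> e ep; apply: pF; rewrite inE ep orbT.
exists (symdiff [set d.1] J) => [|v].
  apply/subsetP=> e; rewrite !inE; case: eqP => [-> _|_ /(subsetP JF)] //.
  by apply: pF; rewrite inE eqxx.
rewrite parity_symdiff {1}/parity big_set1 ends_parity_dart parJ.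
by rewrite -addbA (addbA (v == dst d)) addbb.
Qed.

Definition component_parity F (T : 'I_(nv G) -> bool) x : bool :=
  \big[addb/false]_(v in connect (edge_rel F) x) T v.

Lemma component_parityD F (T1 T2 : 'I_(nv G) -> bool) x :
  component_parity F (fun v => T1 v (+) T2 v) x =
  component_parity F T1 x (+) component_parity F T2 x.
Proof. exact: big_split. Qed.

Lemma component_parity1 F x y :
  component_parity F (fun v => v == y) x = connect (edge_rel F) x y.
Proof. exact: sum_pred1. Qed.

(** The handshake lemma inside one component: an edge of [J] has both ends in it or none. *)
Lemma component_parity_sub F J x : J \subset F ->
  component_parity F (parity J) x = false.
Proof.
move=> JF; apply: sum_parity => d dJ; rewrite -!topredE /=.
exact/connect_dart/(subsetP JF).
Qed.

Lemma component_parity_connect F T x y : connect (edge_rel F) x y ->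
  component_parity F T x = component_parity F T y.
Proof.
move=> cxy; apply: eq_bigl => v; rewrite -!topredE /=.
exact: (same_connect (@edge_connect_sym F)).
Qed.

(** Induction on the size of [T]. Evenness gives any vertex of [T] a partner in its component; a set
    joining the two removes both from [T] and is added modulo 2 to a join of the others. *)
Lemma T_join F (T : 'I_(nv G) -> bool) :
  (forall x, component_parity F T x = false) ->
  exists2 J : {set _}, J \subset F & parity J =1 T.
Proof.
have [n] := ubnP #|T|; elim: n T => // n IH T ltTn evenT.
have [x Tx|T0] := pickP T; last first.
  by exists set0; rewrite ?sub0set // => v; rewrite /parity big_set0 T0.
have [y /and3P[Ty nyx cxy]|Tx1] :=
  pickP (fun y => [&& T y, y != x & connect (edge_rel F) x y]); last first.
  have := evenT x; rewrite /component_parity (bigD1 x) ?inE -?topredE //=.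
  rewrite Tx big1 // => v /andP[cxv nvx]; apply/negP => Tv.
  by have := Tx1 v; rewrite Tv nvx [connect _ _ _]cxv.
have [J0 J0F parJ0] := path_join cxy.
have [|x'|J JF parJ] := IH (fun v => T v (+) ((v == x) (+) (v == y))).
- rewrite ltnS in ltTn; apply: leq_trans ltTn; apply: proper_card.
  rewrite properE; apply/andP; split.
    apply/subsetP=> v; rewrite -!topredE /=.
    by case: (v =P x) => [->|_]; rewrite ?Tx //; case: (v =P y) => [->|_]; rewrite ?Ty ?addbF.
  apply/subsetPn; exists x; rewrite -?topredE //= Tx eqxx eq_sym.
  by rewrite (negbTE nyx).
- rewrite component_parityD evenT component_parityD !component_parity1.
  by rewrite (same_connect_r (@edge_connect_sym F) cxy) addbb.
exists (symdiff J J0) => [|v].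
  apply/subsetP=> e; rewrite inE.
  by case: (boolP (e \in J)) => [/(subsetP JF)|_ /(subsetP J0F)].
by rewrite parity_symdiff parJ parJ0 -addbA addbb addbF.
Qed.

Section Component.
Variables (F : {set 'I_(ne G)}) (x : 'I_(nv G)).

Lemma component_ends e :
  e \in [set e in F | connect (edge_rel F) x (ends e).1] ->
  ((ends e).1 \in [set v | connect (edge_rel F) x v]) &&
  ((ends e).2 \in [set v | connect (edge_rel F) x v]).
Proof.
rewrite !inE => /andP[eF cxe]; rewrite cxe.
by have /= <- := @connect_dart F (e, false) x eF.
Qed.

Definition component : subgraph G := Subgraph component_ends.

Lemma component_connected : connected component.
Proof.
split=> [|y z]; first by exists x; rewrite inE.
rewrite !inE => cxy cxz.
have cyz : connect (edge_rel F) y z.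
  by rewrite -(same_connect (@edge_connect_sym F) cxy).
have [p [wp pF endp]] := connect_walk cyz.
exists p; split=> //; split=> //; first by rewrite inE.
move=> e ep; rewrite inE pF //=; apply: connect_trans cxy _.
have ed : (e, false).1 \in walk_edges p by [].
by apply: (walk_connect wp pF); have [] := edge_of_walk wp ed.
Qed.

Lemma component_edgesP v : connect (edge_rel F) x v ->
  parity (sE component) v = parity F v.
Proof.
move=> cxv; rewrite /parity !(big_mkcond (fun e => e \in _)).
apply: eq_bigr => e _; rewrite inE; case: ifP => [/andP[-> //]|].
case: (boolP (e \in F)) => //= eF ncxe; symmetry.
have /= cx2 := @connect_dart F (e, false) x eF.
rewrite /src /dst /= in cx2; apply/negbTE/negP; rewrite /ends_parity.
case: eqP => [ev|_]; first by rewrite ev cxv in ncxe.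
by case: eqP => [ev|//]; rewrite cx2 ev cxv in ncxe.
Qed.

Lemma component_edgesN v : ~~ connect (edge_rel F) x v ->
  parity (sE component) v = false.
Proof.
move=> ncxv; rewrite /parity big1 // => e /component_ends; rewrite !inE => /andP[h1 h2].
apply/negbTE/negP; rewrite /ends_parity.
by case: eqP => [ev|_]; [|case: eqP => // ev]; rewrite -ev ?h1 ?h2 in ncxv.
Qed.

End Component.

(** The odd vertices of [H], with [x] and [y] toggled, form a set that is even in each component of
    [G - E(H)]. Adding a T-join of it to [H] corrects all degrees, and the component of [x] then
    contains all of the connected [H]. *)
Lemma trail_of_component_parity H x y : connected H -> x \in sV H ->
  (forall c, component_parity (~: sE H) (parity (sE H)) c =
     connect (edge_rel (~: sE H)) c x (+) connect (edge_rel (~: sE H)) c y) ->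
  exists2 K, contained H K &
    exists p, [/\ trail_in K x p, walk_end x p = y & covers K x p].
Proof.
move=> [_ conH] xH parH.
have [c|J JF parJ] := @T_join (~: sE H)
  (fun v => parity (sE H) v (+) ((v == x) (+) (v == y))).
  by rewrite !component_parityD parH !component_parity1 addbb.
set F := sE H :|: J; pose K := component F x.
have parF v : parity F v = (v == x) (+) (v == y).
  rewrite parityU; first by rewrite parJ addbA addbb.
  by rewrite disjoint_sym disjoints_subset.
have VHK : sV H \subset sV K.
  apply/subsetP=> v vH; rewrite inE.
  have [p [[_ pH wp] <-]] := conH _ _ xH vH.
  apply: (walk_connect wp); last exact: mem_last.
  by move=> e /pH; rewrite inE => ->.
exists K.
  split=> //; apply/subsetP=> e eH; rewrite !inE eH /=.
  by case/andP: (sE_ends eH) => /(subsetP VHK); rewrite inE.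
apply: covering_trail; [exact: component_connected | exact: (subsetP VHK)|].
(* If [y] were elsewhere, [x] would be the only odd vertex of its component. *)
have cxy : connect (edge_rel F) x y.
  have: component_parity F (parity (sE K)) x = false.
    by apply: component_parity_sub; apply/subsetP=> e; rewrite inE => /andP[].
  rewrite /component_parity; under eq_bigr => v cxv do
    rewrite component_edgesP // parF.
  by rewrite big_split /= !sum_pred1 -!topredE /= connect0 => /negbFE.
move=> v; case: (boolP (connect (edge_rel F) x v)) => cxv.
  by rewrite component_edgesP.
rewrite component_edgesN //.
by case: eqP cxv => [->|_]; [rewrite connect0 | case: eqP => [->|//]; rewrite cxy].
Qed.

(** The edges that [K] adds avoid [E(H)], so they contribute evenly to each component; up to them
    [H] has the parities of [K], which are those of the trail. *)
Lemma component_parity_of_trail H K x p c : contained H K -> trail_in K x p ->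
  covers K x p ->
  component_parity (~: sE H) (parity (sE H)) c =
    connect (edge_rel (~: sE H)) c x (+)
    connect (edge_rel (~: sE H)) c (walk_end x p).
Proof.
move=> [_ HK] [[_ pK wp] up] [Kp _].
have parK v : parity (sE K) v = (v == x) (+) (v == walk_end x p).
  rewrite -(parity_walk v wp up); congr parity; apply/setP => e; rewrite inE.
  by apply/idP/idP => [/Kp|/pK].
have := @component_parity_sub (~: sE H) (sE K :\: sE H) c.
rewrite setDE subsetIr => /(_ isT) parJ.
rewrite -[LHS]addbF -{}parJ -component_parityD -!component_parity1 -component_parityD.
apply: eq_bigr => v _; rewrite -parK -parityU; last first.
  by rewrite disjoint_sym disjoints_subset subsetIr.
by congr parity; rewrite -{1}(setIidPr HK) -setDE setID.
Qed.

(** * Odd components and the two characterizations *)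

Definition odd_component H : pred 'I_(nv G) :=
  component_parity (~: sE H) (parity (sE H)).

Definition linked H : rel 'I_(nv G) := connect (edge_rel (~: sE H)).

Definition has_exit H : Prop :=
  exists d : dart G, [/\ d.1 \notin sE H, src d \in sV H & src d <> dst d].

Lemma linked_sym H : symmetric (linked H).
Proof. exact: edge_connect_sym. Qed.

(** Vertices outside of [H] have degree 0 in [H]. This provides a starting vertex in [H] for an open
    trail. *)
Lemma odd_component_vertex H c : odd_component H c ->
  exists2 v, v \in sV H & linked H c v.
Proof.
move=> oddc.
have [v /andP[cv vH]|none] := pickP [pred v | linked H c v & v \in sV H].
  by exists v.
have : odd_component H c = false; last by rewrite oddc.
rewrite /odd_component /component_parity big1 // => v cv.
have vNH : v \notin sV H by have /= := none v; rewrite [linked H c v]cv /= => ->.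
rewrite /parity big1 // => e /sE_ends /andP[h1 h2]; apply/negbTE/negP.
rewrite /ends_parity.
by case: eqP => [ev|_]; [|case: eqP => // ev]; rewrite -ev ?h1 ?h2 in vNH.
Qed.

Lemma S_EulerianP H : connected H ->
  S_Eulerian H <-> forall c, ~~ odd_component H c.
Proof.
move=> conH; split=> [[K [HK [x [p [trp endp cov]]]]] c | even].
  rewrite /odd_component (component_parity_of_trail c HK trp cov) endp.
  by rewrite addbb.
have [x xH] := conH.1.
have [c|K HK [p [trp endp cov]]] := trail_of_component_parity (y := x) conH xH.
  by rewrite addbb; apply/negbTE/even.
by exists K; split=> //; exists x, p.
Qed.

Lemma semi_S_Eulerian_of_parity H x y : connected H -> x \in sV H -> x <> y ->
  (forall c, odd_component H c = linked H c x (+) linked H c y) ->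
  semi_S_Eulerian H.
Proof.
move=> conH xH nxy par_c.
have [K HK [p [trp endp cov]]] := trail_of_component_parity conH xH par_c.
by exists K; split=> //; exists x, p; rewrite endp; split=> // yx; apply: nxy.
Qed.

(* Without an exit, [H'] can only add loops to [H]. *)
Lemma trail_without_exit H K x p : contained H K -> connected H ->
  trail_in K x p -> covers K x p -> ~ has_exit H ->
  x \in sV H /\ forall v, linked H x v -> v = x.
Proof.
move=> [HKv _] [[h hH] _] [[_ _ wp] _] [_ Kp] noexit.
have stay d : d.1 \notin sE H -> src d \in sV H -> src d = dst d.
  by move=> dH sH; apply/eqP/negPn/negP => /eqP ne; apply: noexit; exists d.
(* All edges preserve membership in [H]: those of [H] have both ends there, and any other edge that
   meets [H] is a loop. *)
have step d : (src d \in sV H) = (dst d \in sV H).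
  case: (boolP (d.1 \in sE H)) => [/sE_ends /andP[]|dH].
    by rewrite /src /dst; case: ifP => _ -> ->.
  apply/idP/idP => [sH|dsH]; first by rewrite -stay.
  by rewrite -src_flip in dsH; rewrite -dst_flip -stay.
have xH : x \in sV H.
  have: h \in walk_vertices x p by apply/Kp/(subsetP HKv).
  case/walk_vertices_split=> p1 [p2 [defp endp1]]; move: wp.
  rewrite defp is_walk_cat => /andP[wp1 _]; rewrite -{}endp1 in hH.
  elim: p1 x wp1 hH {defp p p2 Kp} => //= d p1 IH x /andP[/eqP <- wp1] hH.
  by rewrite step; apply: IH.
split=> // v /connect_walk[q [wq qH <-]]; elim: q wq qH => //= d q IH.
case/andP=> /eqP sd wq qH; rewrite /walk_end /=.
have dx : dst d = x.
  by rewrite -stay // ?sd // -in_setC; apply: qH; rewrite inE eqxx.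
by rewrite dx in wq *; apply: IH => // e eq; apply: qH; rewrite inE eq orbT.
Qed.

Lemma semi_S_EulerianP H : connected H ->
  semi_S_Eulerian H <->
    (exists x y, [/\ ~~ linked H x y, odd_component H x, odd_component H y &
       forall z, odd_component H z -> linked H x z \/ linked H y z]) \/
    ((forall c, ~~ odd_component H c) /\ has_exit H).
Proof.
have linkE u v w : linked H u v -> linked H u w = linked H v w.
  by move=> luv; apply: (same_connect (@edge_connect_sym (~: sE H))).
move=> conH; split=> [[K [HK [x [p [trp]]]]]|].
  move: {1 3}(walk_end _ _) (erefl (walk_end x p)) => y endp nyx cov.
  have oddE c : odd_component H c = linked H c x (+) linked H c y.
    by rewrite /odd_component (component_parity_of_trail c HK trp cov) -endp.
  (* If [x] and [y] are linked, they cancel in each component; otherwise exactly the components of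
     [x] and of [y] are odd. *)
  case: (boolP (linked H x y)) => lxy; [right | left].
    split=> [c|].
      by rewrite oddE !(linked_sym _ c) -(linkE _ _ _ lxy) addbb.
    case: (boolP [exists d : dart G,
        [&& d.1 \notin sE H, src d \in sV H & src d != dst d]]).
      by case/existsP=> d /and3P[? ? /eqP ?]; exists d.
    move=> noexit; have [|_ /(_ y lxy)] := trail_without_exit HK conH trp cov.
      case=> d [dH sH /eqP ne]; case/existsP: noexit; exists d.
      by rewrite dH sH.
    by move/nyx.
  exists x, y; split=> // [||z].
  - by rewrite oddE (negbTE lxy) /linked connect0.
  - by rewrite oddE linked_sym (negbTE lxy) /linked connect0.
  - by rewrite oddE !(linked_sym _ z); case: (linked H x z); [left|right].
case=> [[x [y [nxy oddx oddy odd_xy]]] | [even [d [dH sH ne]]]]; last first.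
  (* The trail runs between the ends of the exit: the exit itself links them, so they cancel in each
     component. *)
  apply: semi_S_Eulerian_of_parity conH sH ne _ => c.
  by rewrite (negbTE (even c)) /linked (@connect_dart _ d) ?inE // addbb.
(* The trail has to start in [H], so [x] is replaced by a vertex of [H] in its component. *)
have [u uH lxu] := odd_component_vertex oddx.
apply: (@semi_S_Eulerian_of_parity _ u y) => // [uy|c]; first by rewrite -uy lxu in nxy.
rewrite !(linked_sym _ c) -(linkE _ _ _ lxu).
case: (boolP (odd_component H c)) => [oddc|evenc].
  have [lxc|lyc] := odd_xy c oddc.
    rewrite lxc; apply/esym/negP => lyc.
    by rewrite linked_sym (linkE _ _ _ lyc) linked_sym lxc in nxy.
  rewrite lyc addbT; apply/esym/negP => lxc.
  by rewrite linked_sym (linkE _ _ _ lyc) linked_sym lxc in nxy.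
have far z : odd_component H z -> linked H z c = false.
  move=> oddz; apply/negP => lzc.
  by rewrite /odd_component -(component_parity_connect _ lzc) [component_parity _ _ _]oddz in evenc.
by rewrite (far y oddy) (far x oddx).
Qed.

End Parity.

(** * Structured programs on the random access machine *)

(* [Ifz r c1 c2] runs [c1] if register [r] is zero and [c2] otherwise;
   [Loop r c] repeats [c] until register [r] is zero. *)
Inductive cmd :=
| Prim of instr
| Seq of cmd & cmd
| Ifz of nat & cmd & cmd
| Loop of nat & cmd.

Notation "c1 ;; c2" := (Seq c1 c2) (at level 60, right associativity).
Coercion Prim : instr >-> cmd.

(** Jump targets are absolute, so the code depends on the address [l] of its first instruction. *)
Fixpoint code (l : nat) (c : cmd) : seq instr :=
  match c with
  | Prim i => [:: i]
  | Seq c1 c2 => let p1 := code l c1 in p1 ++ code (l + size p1) c2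
  | Ifz r c1 c2 =>
      let p2 := code l.+1 c2 in
      let l1 := l + (size p2).+2 in
      let p1 := code l1 c1 in
      Jzero r l1 :: p2 ++ Jump (l1 + size p1) :: p1
  | Loop r c =>
      let p := code l.+1 c in
      Jzero r (l + (size p).+2) :: rcons p (Jump l)
  end.

(* Contents of the registers and of the memory. *)
Definition store : Type := ((nat -> nat) * (nat -> nat))%type.

Definition at_pc (l : nat) (s : store) : state := State l s.1 s.2.

Definition basic (i : instr) : bool :=
  match i with Jump _ | Jzero _ _ | Halt _ => false | _ => true end.

Fixpoint flat (c : cmd) : bool :=
  match c with
  | Prim i => basic i
  | Seq c1 c2 | Ifz _ c1 c2 => flat c1 && flat c2
  | Loop _ _ => false
  end.

Fixpoint eval (c : cmd) (s : store) : store :=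
  match c with
  | Prim i => let s' := exec i (at_pc 0 s) in (reg s', Defs.mem s')
  | Seq c1 c2 => eval c2 (eval c1 s)
  | Ifz r c1 c2 => if s.1 r == 0 then eval c1 s else eval c2 s
  | Loop _ _ => s
  end.

(** An upper bound for flat commands: both branches of a conditional are added, and 2 more
    instructions cover its [Jzero] and [Jump]. *)
Fixpoint cost (c : cmd) : nat :=
  match c with
  | Prim _ => 1
  | Seq c1 c2 | Ifz _ c1 c2 => (cost c1 + cost c2).+2
  | Loop _ _ => 0
  end.

(** * Execution of compiled code within a time bound *)

Lemma run_leq P t t' s b : t <= t' -> run P t s = Some b -> run P t' s = Some b.
Proof.
elim: t t' s => // t IH [|t'] s //= le_tt'; case: (onth P (pc s)) => // i.
by case: i => //= *; apply: IH.
Qed.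

(** Stated through final answers, so that [t] only has to bound the number of instructions between
    the two states. *)
Definition reaches (P : program) (t : nat) (s s' : state) : Prop :=
  forall t' b, run P t' s' = Some b -> run P (t + t') s = Some b.

Lemma reaches_trans P t1 t2 t s1 s2 s3 : t1 + t2 <= t ->
  reaches P t1 s1 s2 -> reaches P t2 s2 s3 -> reaches P t s1 s3.
Proof.
move=> le_t r12 r23 t' b /r23/r12; apply: run_leq.
by rewrite addnA leq_add2r.
Qed.

Lemma reaches0 P s : reaches P 0 s s.
Proof. by []. Qed.

Definition occurs (p : seq instr) (P : program) (l : nat) : Prop :=
  forall i, i < size p -> onth P (l + i) = onth p i.

Lemma occurs_cat p1 p2 P l :
  occurs (p1 ++ p2) P l -> occurs p1 P l /\ occurs p2 P (l + size p1).
Proof.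
move=> occ; split=> i lti.
  by rewrite occ ?size_cat ?ltn_addr // onth_cat lti.
rewrite -addnA occ ?size_cat ?ltn_add2l // onth_cat.
by rewrite ltnNge leq_addr /= addKn.
Qed.

Lemma occurs_cons i p P l :
  occurs (i :: p) P l -> onth P l = Some i /\ occurs p P l.+1.
Proof.
move=> occ; split; first by have := occ 0 isT; rewrite addn0.
by move=> j ltj; rewrite addSnnS occ.
Qed.

Lemma reaches_exec P i s : onth P (pc s) = Some i ->
  (if i is Halt _ then false else true) -> reaches P 1 s (exec i s).
Proof. by case: i => // [r k|r a|r a b|r a b|r a|a r|l|a l] Pi _ t' ?; rewrite add1n /= Pi. Qed.

Lemma reaches_flat P c l s : flat c -> occurs (code l c) P l ->
  reaches P (cost c) (at_pc l s) (at_pc (l + size (code l c)) (eval c s)).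
Proof.
elim: c l s => //=.
- move=> i l s bi /occurs_cons[Pi _].
  have := @reaches_exec P i (at_pc l s); rewrite /= addn1.
  by case: i bi Pi => //= *; auto.
- move=> c1 IH1 c2 IH2 l s /andP[f1 f2] /occurs_cat[o1 o2].
  rewrite size_cat addnA.
  by apply: reaches_trans (IH1 _ _ f1 o1) (IH2 _ _ f2 o2); lia.
move=> r c1 IH1 c2 IH2 l s /andP[f1 f2] /occurs_cons[Pr].
case/occurs_cat=> o2 /occurs_cons[Pj o1].
have := @reaches_exec P _ (at_pc l s) Pr isT; rewrite /= size_cat /=.
set p2 := code l.+1 c2 in o2 Pj o1 *; set l1 := l + (size p2).+2 in o1 Pj *.
have l1E : (l.+1 + size p2).+1 = l1 by rewrite /l1; lia.
rewrite l1E in o1.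
have -> : l + (size p2 + (size (code l1 c1)).+1).+1 = l1 + size (code l1 c1).
  by rewrite /l1; lia.
case: eqP => _ r0; first by apply: reaches_trans r0 (IH1 _ _ f1 o1); lia.
have rj := @reaches_exec P _ (at_pc (l.+1 + size p2) (eval c2 s)) Pj isT.
by apply: reaches_trans r0 (reaches_trans (leqnn _) (IH2 _ _ f2 o2) rj); lia.
Qed.

(** A Hoare triple for total correctness with a time bound, required at every address where the code
    may be placed. *)
Definition triple (I : store -> Prop) (c : cmd) (t : nat) (J : store -> Prop) :=
  forall P l s, occurs (code l c) P l -> I s ->
  exists2 s', J s' & reaches P t (at_pc l s) (at_pc (l + size (code l c)) s').

Lemma triple_weaken I J c t t' : t <= t' -> triple I c t J -> triple I c t' J.
Proof.
move=> le_t tr P l s occ /(tr P l s occ)[s' Js' r]; exists s' => //.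
by apply: reaches_trans r (@reaches0 _ _); rewrite addn0.
Qed.

Lemma triple_flat (I J : store -> Prop) c : flat c ->
  (forall s, I s -> J (eval c s)) -> triple I c (cost c) J.
Proof.
by move=> fc IJ P l s occ Is; exists (eval c s); [apply: IJ | apply: reaches_flat].
Qed.

Lemma triple_seq I J K c1 c2 t1 t2 :
  triple I c1 t1 J -> triple J c2 t2 K -> triple I (c1 ;; c2) (t1 + t2) K.
Proof.
move=> tr1 tr2 P l s /occurs_cat[o1 o2].
case/(tr1 _ _ _ o1)=> s1 /(tr2 _ _ _ o2)[s2 Ks2 r2] r1.
exists s2 => //; rewrite /= size_cat addnA.
by apply: reaches_trans r1 r2.
Qed.

(** The index [k] is a potential that bounds the number of rounds left. A round costs its body, the
    [Jzero] and the [Jump] back; the final 1 is the last test. *)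
Lemma triple_loop (I : nat -> store -> Prop) r c m : flat c ->
  (forall k s, I k s -> s.1 r != 0 -> exists2 k', k' < k & I k' (eval c s)) ->
  triple (fun s => exists2 k, k <= m & I k s) (Loop r c) ((cost c + 2) * m + 1)
    (fun s => (exists k, I k s) /\ s.1 r = 0).
Proof.
move=> fc stepI P l s; rewrite /=; set p := code l.+1 c.
case/occurs_cons; rewrite -cats1 => Pr /occurs_cat[oc /occurs_cons[Pj _]] [k km Ik].
rewrite size_cat (addn1 (size p)).
elim: m k s km Ik => [|m IH] k s km Ik; have := @reaches_exec P _ (at_pc l s) Pr isT.
all: rewrite /=; case: eqP => [r0|/eqP nr0] step.
- exists s; [by split=> //; exists k|]. by apply: reaches_trans step (@reaches0 _ _); lia.
- by have [k' ] := stepI _ _ Ik nr0; lia.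
- exists s; first by split=> //; exists k.
  by apply: reaches_trans step (@reaches0 _ _); lia.
have [k' k'k Ik'] := stepI _ _ Ik nr0.
have [|s' Js' r'] := IH k' _ _ Ik'; first by lia.
exists s' => //.
have rj := @reaches_exec P _ (at_pc (l.+1 + size p) (eval c s)) Pj isT.
apply: reaches_trans step (reaches_trans (leqnn _) (reaches_flat fc oc)
  (reaches_trans (leqnn _) rj r')); lia.
Qed.

Definition decision (c : cmd) (r : nat) : program :=
  let p := code 0 c in p ++ [:: Jzero r (size p).+2; Halt true; Halt false].

Lemma run_decision c r t (I J : store -> Prop) s : triple I c t J -> I s ->
  exists2 s', J s' & run (decision c r) (t + 2) (at_pc 0 s) = Some (s'.1 r != 0).
Proof.
move=> tr Is; rewrite /decision; set p := code 0 c; set P := _ ++ _.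
have oP : occurs P P 0 by [].
have [op /occurs_cons[P0 /occurs_cons[P1 /occurs_cons[P2 _]]]] := occurs_cat oP.
rewrite add0n -/p in P0 P1 P2; have [s' Js' reach] := tr _ _ _ op Is.
exists s' => //; apply: reach; rewrite add0n -/p /= P0 /=.
by case: (s'.1 r == 0); rewrite ?P1 ?P2.
Qed.

(** * The search *)

Section Search.
Variables (G : graph) (H : subgraph G).
Variable adj : 'I_(nv G) -> seq ('I_(nv G) * bool).
Hypothesis adjE : adjacency_lists H adj.
Local Notation V := 'I_(nv G).
Implicit Types (u v w : V).

Local Notation outer := (edge_rel (~: sE H)).

Lemma mem_adj v w : (w, false) \in adj v = outer v w.
Proof.
rewrite (perm_mem (adjE v)); apply/mapP/edge_relP => -[d].
  by rewrite mem_filter => /andP[/eqP sd _] [-> /esym/negbT dH]; exists d; rewrite inE.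
rewrite inE => -[/negbTE dH sd dd]; exists d; last by rewrite dd dH.
by rewrite mem_filter sd eqxx mem_enum.
Qed.

Lemma odd_count (T : Type) (p : pred T) s :
  odd (count p s) = \big[addb/false]_(x <- s) p x.
Proof. by elim: s => [|x s IH]; rewrite ?big_nil // big_cons /= oddD IH oddb. Qed.

(** An edge of [H] gives one marked entry for each of its darts, so a loop is counted twice and
    cancels, as in [ends_parity]. *)
Lemma odd_count_adj v : odd (count snd (adj v)) = parity (sE H) v.
Proof.
rewrite (permP (adjE v)) count_map odd_count big_filter big_enum_cond /=.
rewrite (big_mkcond (fun d => _ == _)) /parity (big_mkcond (fun e => _ \in _)).
rewrite -(pair_bigA _ (fun e b => if src (e, b) == v then e \in sE H else false)) /=.
apply: eq_bigr => e _; rewrite big_bool /ends_parity /src /=.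
by case: (e \in sE H); do 2!case: (_ == v).
Qed.

Lemma sum_size_adj : \sum_v size (adj v) = 2 * ne G.
Proof.
transitivity #|dart G|; last by rewrite card_prod card_ord card_bool mulnC.
under eq_bigr => v _ do rewrite (perm_size (adjE v)) size_map -sum1_size big_filter big_enum_cond.
by rewrite -sum1_card (partition_big (@src G) xpredT).
Qed.

(* Breadth first search in the graph [G - E(H)]. The vertices found so far are
   in [queue], the first [taken] of them have been taken up, the last of these
   being [cur], whose list has been read up to [rest]. *)
Record bfs := Bfs {
  tried : nat;
  queue : seq V;
  taken : nat;
  cur : V;
  rest : seq (V * bool);
  odd_now : bool;
  odds : nat;
  exits : bool;
  running : bool }.

Definition visit v (q : seq V) := if v \in q then q else rcons q v.

Definition enqueue v a :=
  Bfs (tried a) (visit v (queue a)) (taken a) (cur a) (rest a) (odd_now a)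
    (odds a) (exits a) (running a).

Definition read_entry (x : V * bool) r a :=
  Bfs (tried a) (queue a) (taken a) (cur a) r (x.2 (+) odd_now a) (odds a)
    (exits a || [&& ~~ x.2, cur a \in sV H & x.1 != cur a]) (running a).

Definition dequeue a :=
  let v := nth (cur a) (queue a) (taken a) in
  Bfs (tried a) (queue a) (taken a).+1 v (adj v) (odd_now a)
    (odds a) (exits a) (running a).

Definition close_component a :=
  Bfs (tried a) (queue a) (taken a) (cur a) (rest a) false
    (odds a + odd_now a) (exits a) (running a).

Definition next_root a :=
  Bfs (tried a).+1 (queue a) (taken a) (cur a) (rest a) (odd_now a)
    (odds a) (exits a) (running a).

Definition stop a :=
  Bfs (tried a) (queue a) (taken a) (cur a) (rest a) (odd_now a)
    (odds a) (exits a) false.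

(** If the next root is in the queue already, the following round closes a component again; that one
    is empty and [odd_now] is false, so [odds] does not change. *)
Definition step a :=
  match rest a with
  | x :: r => read_entry x r (if x.2 then a else enqueue x.1 a)
  | [::] =>
    if taken a < size (queue a) then dequeue a else
    let a' := close_component a in
    if insub (tried a) is Some v then next_root (enqueue v a') else stop a'
  end.

Definition start v := Bfs 0 [::] 0 v [::] false 0 false true.

(** Bounds the rounds left: one for each entry not yet read, each vertex not yet taken up, each root
    not yet tried, and one for stopping. *)
Definition measure a :=
  size (rest a) + \sum_(v | v \notin take (taken a) (queue a)) (size (adj v)).+1
  + (nv G - tried a) + running a.

(* The first [m] elements of the queue form a union of components, of which the
   odd ones are represented in [rs]; the other elements belong to one
   component, the current one. *)
Record search_inv a m (rs : seq V) : Prop := Inv {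
  inv_uniq : uniq (queue a);
  inv_m : m <= taken a;
  inv_head : taken a <= size (queue a);
  inv_closed : forall v w, v \in take m (queue a) -> outer v w ->
    w \in take m (queue a);
  inv_linked : forall v w, v \in drop m (queue a) -> w \in drop m (queue a) ->
    linked H v w;
  inv_scanned : forall v w, v \in take (taken a) (queue a) -> outer v w ->
    w \in queue a \/ v = cur a /\ (w, false) \in rest a;
  inv_cur : forall x, x \in rest a ->
    cur a \in drop m (queue a) /\ x \in adj (cur a);
  inv_odd_now : odd_now a (+) odd (count snd (rest a)) =
    \big[addb/false]_(v <- drop m (take (taken a) (queue a))) parity (sE H) v;
  inv_odds : odds a = size rs;
  inv_rs : forall r, r \in rs -> odd_component H r /\ r \in take m (queue a);
  inv_rs_apart : pairwise (fun r r' => ~~ linked H r r') rs;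
  inv_rs_all : forall v, v \in take m (queue a) -> odd_component H v ->
    exists2 r, r \in rs & linked H r v;
  inv_root : forall v, v < tried a -> v \in queue a;
  inv_exit : exits a -> has_exit H;
  inv_no_exit : forall v w, v \in take (taken a) (queue a) -> v \in sV H ->
    outer v w -> w <> v -> exits a \/ v = cur a /\ (w, false) \in rest a;
  inv_stopped : ~~ running a ->
    rest a = [::] /\ forall v, v \in take m (queue a) }.

(** * Preservation of the invariant and decrease of the measure *)

Lemma inv_start v : search_inv (start v) 0 [::].
Proof. by split; rewrite //= big_nil. Qed.

(** The hypothesis fits both uses: [v] is a neighbour of the current component, or a root while that
    component is empty. New vertices go behind the prefixes of which the invariant speaks. *)
Lemma inv_enqueue a m rs v : search_inv a m rs ->
  (forall w, w \in drop m (queue a) -> linked H w v) ->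
  search_inv (enqueue v a) m rs.
Proof.
case: a => rt q h c r p k f g; rewrite /enqueue /visit /=.
case: ifPn => // vq [] /= uq mh hq clo lnk scn cu par ksz rsP apart all rts ex nex st lv.
have tk i : i <= size q -> take i (rcons q v) = take i q.
  by move=> iq; rewrite -cats1 takel_cat.
have mq := leq_trans mh hq.
split=> //=.
- by rewrite rcons_uniq vq.
- by rewrite size_rcons leqW.
- by move=> x y; rewrite tk //; apply: clo.
- move=> x y; rewrite drop_rcons // !mem_rcons !inE.
  move=> /predU1P[->|xq] /predU1P[->|yq]; [exact: connect0 | | exact: lv| exact: lnk].
  by rewrite linked_sym lv.
- move=> x y; rewrite tk // => xq /(scn _ _ xq)[yq|]; last by right.
  by left; rewrite mem_rcons inE yq orbT.
- by move=> x /cu[cq ->]; rewrite drop_rcons // mem_rcons inE cq orbT.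
- by rewrite tk.
- by move=> x /rsP; rewrite tk.
- by move=> x; rewrite tk //; apply: all.
- by move=> x /rts xq; rewrite mem_rcons inE xq orbT.
- by move=> x y; rewrite tk //; apply: nex.
- by move=> /st[r0 all_q]; split=> // x; rewrite tk.
Qed.

Lemma inv_read_entry a m rs x r : search_inv a m rs -> rest a = x :: r ->
  (~~ x.2 -> x.1 \in queue a) -> search_inv (read_entry x r a) m rs.
Proof.
case: a => rt q h c r0 p k f g + r0E; rewrite /= in r0E; subst r0.
case=> /= uq mh hq clo lnk scn cu par ksz rsP apart all rts ex nex st xq.
have [cq xadj] := cu x (mem_head _ _).
split=> //=.
- move=> v w vq vw; have [|[vc]] := scn v w vq vw; first by left.
  rewrite inE => /predU1P[xE|]; last by right.
  by left; move: xq; rewrite -xE => /(_ isT).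
- by move=> y yr; split=> //; have [] := cu y; rewrite ?inE ?yr ?orbT.
- by rewrite -par oddD oddb addbCA addbA.
- case: f ex nex => // ex nex /and3P[/negbTE nx2 cH ne].
  have /edge_relP[d [dH sd dd]] : outer c x.1.
    by rewrite -mem_adj -nx2 -surjective_pairing.
  exists d; split; [by rewrite inE in dH | by rewrite sd |].
  by rewrite sd dd; move/eqP: ne => ne e; apply: ne.
- move=> v w vq vH vw nwv; have [->|[vc]] := nex v w vq vH vw nwv; first by left.
  rewrite inE => /predU1P[xE|]; last by right.
  by left; move/eqP: nwv; rewrite -xE -vc /= vH => ->; rewrite orbT.
- by case/st.
Qed.

(** The whole list of the new vertex is unread, so the demands on its edges are met through [rest];
    its degree parity enters as the count of marked entries there. *)
Lemma inv_dequeue a m rs : search_inv a m rs -> running a -> rest a = [::] ->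
  taken a < size (queue a) -> search_inv (dequeue a) m rs.
Proof.
case: a => rt q h c r p k f [] // + _ r0; rewrite /= in r0; subst r.
case=> /= uq mh hq clo lnk scn cu par ksz rsP apart all rts ex nex _ hlt.
set v := nth c q h.
have tkE : take h.+1 q = rcons (take h q) v by rewrite (take_nth c).
rewrite addbF in par.
split=> //=.
- exact: leqW.
- move=> x w; rewrite tkE mem_rcons inE => /predU1P[->|xq xw].
    by right; rewrite mem_adj.
  by left; have [|[]] := scn x w xq xw.
- move=> x xv; split=> //; rewrite /v -(subnKC mh) -nth_drop mem_nth // size_drop.
  by rewrite ltn_sub2r // (leq_ltn_trans mh).
- rewrite tkE drop_rcons ?size_take ?hlt // -cats1 big_cat big_seq1 /= -par.
  by rewrite odd_count_adj.
- move=> x w; rewrite tkE mem_rcons inE => /predU1P[->|xq xH xw nwx].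
    by right; rewrite mem_adj.
  by left; have [|[]] := nex x w xq xH xw nwx.
Qed.

Lemma closed_linked (A : {pred V}) v w :
  (forall x y, x \in A -> outer x y -> y \in A) -> linked H v w -> v \in A -> w \in A.
Proof.
move=> clo /connectP[p]; elim: p v => [|x p IH] v /=; first by move=> _ ->.
by case/andP=> vx px wE vA; apply: IH px wE (clo _ _ vA vx).
Qed.

(** All of the queue has been scanned, so it is closed under edges outside of [H], and so is its
    part behind [m]. Being linked, that part is one component or empty, with parity [odd_now]; if
    odd, its first vertex becomes the representative. *)
Lemma inv_close_component a m rs : search_inv a m rs -> rest a = [::] ->
  size (queue a) <= taken a ->
  exists rs', search_inv (close_component a) (size (queue a)) rs'.
Proof.
case: a => rt q h c r p k f g + r0 hge; rewrite /= in r0 hge *; subst r.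
case=> /= uq mh hq clo lnk scn cu par ksz rsP apart all rts ex nex st.
have {hge hq} hE : h = size q by apply/eqP; rewrite eqn_leq hq.
subst h; rewrite take_size addbF in scn par nex.
have cloq x w : x \in q -> outer x w -> w \in q.
  by move=> xq xw; have [|[]] := scn x w xq xw.
have split_q x : (x \in q) = (x \in take m q) || (x \in drop m q).
  by rewrite -{1}(cat_take_drop m q) mem_cat.
have disj x : x \in take m q -> x \in drop m q -> False.
  move=> xt xd; move: uq; rewrite -(cat_take_drop m q) cat_uniq.
  by case/and3P=> _ /hasPn/(_ x xd); rewrite /= xt.
have clod x w : x \in drop m q -> outer x w -> w \in drop m q.
  move=> xd xw; have: w \in q by apply: cloq xw; rewrite split_q xd orbT.
  rewrite split_q => /orP[wt|//]; rewrite edge_rel_sym in xw.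
  by case: (disj x (clo _ _ wt xw) xd).
have oddE x : x \in drop m q -> odd_component H x = p.
  move=> xd; rewrite par big_uniq ?drop_uniq //; apply: eq_bigl => y.
  rewrite -[LHS]topredE /=; apply/idP/idP; last exact: lnk.
  by move=> xy; apply: closed_linked xy xd.
pose rs' := if p then nth c (drop m q) 0 :: rs else rs.
have d0 : p -> nth c (drop m q) 0 \in drop m q.
  move=> pT; apply: mem_nth; rewrite lt0n size_eq0.
  by apply: contraTneq pT => q0; rewrite par q0 big_nil.
exists rs'; split; rewrite //= ?take_size ?drop_size //.
- by rewrite ?take_size ?drop_size ?big_nil.
- by rewrite ksz /rs'; case: (p); rewrite /= ?addn1 ?addn0.
- have rsq y : y \in rs -> odd_component H y /\ y \in q.
    by move=> /rsP[-> yt]; rewrite split_q yt.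
  move=> y; rewrite /rs'; case: ifP => [pT|_]; last exact: rsq.
  rewrite inE => /predU1P[->|]; last exact: rsq.
  by rewrite oddE ?d0 // split_q d0 ?orbT.
- rewrite /rs'; case: ifP => // pT; rewrite /= apart andbT.
  apply/allP => y /rsP[_ yt]; apply/negP; rewrite linked_sym => yx.
  exact: disj (closed_linked clo yx yt) (d0 pT).
- move=> y; rewrite split_q => /orP[yt oy|yd]; last first.
    rewrite oddE // /rs' => pT; rewrite pT; exists (nth c (drop m q) 0).
      exact: mem_head.
    by apply: lnk => //; apply: d0.
  have [x xrs xy] := all y yt oy; exists x => //.
  by rewrite /rs'; case: ifP; rewrite // inE xrs orbT.
- by move=> /st[_ all_q]; split=> // y; rewrite split_q all_q.
Qed.

Lemma inv_step a m rs : search_inv a m rs -> running a ->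
  exists m' rs', search_inv (step a) m' rs'.
Proof.
move=> Ia run_a; rewrite /step; case rE : (rest a) => [|x r].
  case: ltnP => hq; first by exists m, rs; apply: inv_dequeue.
  have [rs' I'] := inv_close_component Ia rE hq.
  exists (size (queue a)), rs'.
  case: insubP => [v _ vE | nlt].
    (* After the closing, [m] is the length of the queue, so there is no vertex that the new root
       must be linked to. *)
    have Iv : search_inv (enqueue v (close_component a)) (size (queue a)) rs'.
      by apply: inv_enqueue I' _ => w; rewrite /= drop_size.
    case: Iv => *; split=> //= w; rewrite ltnS leq_eqVlt => /predU1P[wE|]; last by auto.
    have -> : w = v by apply: val_inj; rewrite /= wE -vE.
    by rewrite /visit; case: ifP => // _; rewrite mem_rcons mem_head.
  case: I' => *; split=> //= _; split=> // w; rewrite take_size.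
  have lt_w : w < tried a by rewrite -leqNgt in nlt; apply: leq_trans nlt.
  by auto.
exists m, rs; case: ifP => x2; first by apply: inv_read_entry; rewrite ?x2.
apply: inv_read_entry => //=; last first.
  by rewrite /visit; case: ifP => // _; rewrite mem_rcons mem_head.
apply: inv_enqueue => // w wq.
have [cq xadj] := inv_cur Ia (x := x) ltac:(by rewrite rE mem_head).
apply: connect_trans (inv_linked Ia wq cq) _; apply: connect1.
by rewrite -mem_adj -x2 -surjective_pairing.
Qed.

Lemma measure_step a m rs : search_inv a m rs -> running a -> measure (step a) < measure a.
Proof.
move=> Ia run_a; rewrite /step /measure.
have tk v : take (taken a) (visit v (queue a)) = take (taken a) (queue a).
  by rewrite /visit; case: ifP => // _; rewrite -cats1 takel_cat ?(inv_head Ia).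
case rE : (rest a) => [|x r] /=; last by case: (x.2); rewrite /= ?tk; lia.
case: (ltnP (taken a)) => hq /=.
  pose v := nth (cur a) (queue a) (taken a); rewrite /dequeue -/v /=.
  have vd : v \in drop (taken a) (queue a) by rewrite (drop_nth (cur a) hq) mem_head.
  have vq : v \notin take (taken a) (queue a).
    have := inv_uniq Ia; rewrite -{1}(cat_take_drop (taken a) (queue a)) cat_uniq.
    by case/and3P=> _ /hasPn/(_ v vd).
  (* Taking up [v] moves its list from the sum to [rest], and the extra 1 of its term is lost. *)
  rewrite (bigD1 v vq) (take_nth (cur a)) //= -/v.
  rewrite (eq_bigl (fun w => (w \notin take (taken a) (queue a)) && (w != v))) ?addn0.
    by rewrite add0n !addSn.
  by move=> w; rewrite mem_rcons inE negb_or andbC.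
case: insubP => [v lt_n _ | _] /=; rewrite ?rE ?tk run_a /= !add0n ?addn0 ?addn1 ?ltnS //.
by rewrite ltn_add2l ltn_sub2l.
Qed.

Lemma measure_start v : measure (start v) = 2 * ne G + 2 * nv G + 1.
Proof.
rewrite /measure /= subn0 add0n; under eq_bigr => w _ do rewrite -addn1.
rewrite big_split /= sum_size_adj sum_nat_const card_ord muln1.
by rewrite [2 * nv G]mul2n -[in RHS]addnn addnA.
Qed.

(** * The answers read off from the final state *)

Definition answer_closed a := odds a == 0.
Definition answer_open a := (odds a == 2) || (odds a == 0) && exits a.

Lemma odds0P a m rs : search_inv a m rs -> ~~ running a ->
  reflect (forall c, ~~ odd_component H c) (odds a == 0).
Proof.
move=> Ia ng; rewrite (inv_odds Ia) size_eq0; apply: (iffP eqP) => [rs0 c|even].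
  apply/negP => oc; have [r] := inv_rs_all Ia ((inv_stopped Ia ng).2 c) oc.
  by rewrite rs0.
case rsE : (rs) => [//|r rs']; have [] := inv_rs Ia (r := r).
  by rewrite rsE mem_head.
by rewrite (negbTE (even r)).
Qed.

Lemma answer_closedP a m rs : connected H -> search_inv a m rs -> ~~ running a ->
  answer_closed a <-> S_Eulerian H.
Proof. 
move=> conH Ia ng; rewrite /answer_closed S_EulerianP //.
by split=> /(odds0P Ia ng).
Qed.

Lemma answer_openP a m rs : connected H -> search_inv a m rs -> ~~ running a ->
  answer_open a <-> semi_S_Eulerian H.
Proof.
have linkE u v w : linked H u v -> linked H u w = linked H v w.
  by move=> luv; apply: (same_connect (@edge_connect_sym _ (~: sE H))).
move=> conH Ia ng; rewrite /answer_open semi_S_EulerianP // (inv_odds Ia).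
have [rest0 allV] := inv_stopped Ia ng; have apart := inv_rs_apart Ia; split.
  case/orP=> [|/andP[k0 ex]]; last first.
    right; split; last exact: (inv_exit Ia ex).
    by apply/(odds0P Ia ng); rewrite (inv_odds Ia).
  move=> sz2; left; move: sz2 apart (inv_rs Ia) (inv_rs_all Ia).
  case: (rs) => [|x [|y []]] //= _; rewrite !andbT => nxy rsP rs_all.
  exists x, y; split=> // [||z oz].
  - by have [] := rsP x; rewrite ?inE ?eqxx.
  - by have [] := rsP y; rewrite ?inE ?eqxx ?orbT.
  have [r] := rs_all z (allV z) oz.
  by rewrite !inE => /orP[]/eqP->; [left|right].
case=> [[x [y [nxy ox oy only]]] | [even ex]]; last first.
  have /eqP k0 : odds a == 0 by apply/(odds0P Ia ng).
  rewrite -(inv_odds Ia) k0; case: ex => d [dH sH ne].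
  have outer_d : outer (src d) (dst d) by apply/edge_relP; exists d; rewrite inE.
  have dq : src d \in take (taken a) (queue a).
    by move: (allV (src d)); rewrite -(take_takel (queue a) (inv_m Ia)) => /mem_take.
  by have [|->|[_]] := inv_no_exit Ia dq sH outer_d; rewrite ?rest0 // => /esym.
(* [rs] consists of the representatives of the components of [x] and [y], which differ because [x]
   and [y] are not linked. *)
suff -> : size rs = 2 by [].
have [r1 r1s l1] := inv_rs_all Ia (allV x) ox.
have [r2 r2s l2] := inv_rs_all Ia (allV y) oy.
have eq_linked : {in rs &, forall r r', linked H r r' -> r = r'}.
  elim: (rs) apart => //= r s IH /andP[/allP far /IH{}IH] u v.
  rewrite !inE => /predU1P[->|us] /predU1P[->|vs] luv //; last exact: IH.
    by have := far v vs; rewrite luv.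
  by have := far u us; rewrite linked_sym luv.
have uniq_rs : uniq rs.
  rewrite uniq_pairwise; apply: sub_pairwise apart => u v.
  by apply: contra => /eqP ->; apply: connect0.
rewrite -[2]/(size [:: r1; r2]); apply/perm_size/uniq_perm => // [|r].
  rewrite /= andbT inE; apply: contra nxy => /eqP r12.
  by rewrite -(linkE _ _ _ l1) r12.
rewrite !inE; apply/idP/orP => [rs_r | [] /eqP -> //].
have [/only[lxr|lyr] _] := inv_rs Ia rs_r.
  by left; rewrite (eq_linked r r1) // linked_sym (linkE _ _ _ l1).
by right; rewrite (eq_linked r r2) // linked_sym (linkE _ _ _ l2).
Qed.

End Search.

(** * The search on the machine *)

(* Behind the input the memory holds, from [rTable], the address of the input
   block of each vertex, from [rSeen], a flag for each vertex in the queue, and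
   then the queue itself, of which [rHead] and [rTail] are the addresses of
   the next vertex to take up and of the first free cell. [rExits] is nonzero
   rather than one if an exit has been seen. *)
Notation rN := 0 (only parsing).
Notation rOne := 1 (only parsing).
Notation rPtr := 2 (only parsing).
Notation rTodo := 3 (only parsing).
Notation rTable := 4 (only parsing).
Notation rSeen := 5 (only parsing).
Notation rHead := 6 (only parsing).
Notation rTail := 7 (only parsing).
Notation rX := 8 (only parsing).
Notation rY := 9 (only parsing).
Notation rLeft := 10 (only parsing).
Notation rCur := 11 (only parsing).
Notation rMark := 12 (only parsing).
Notation rRoot := 13 (only parsing).
Notation rPar := 14 (only parsing).
Notation rOdds := 15 (only parsing).
Notation rExits := 16 (only parsing).
Notation rRun := 17 (only parsing).
Notation rZ := 18 (only parsing).
Notation rT := 19 (only parsing).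

Definition skip : cmd := Copy rZ rZ.

(* Moves [rPtr] from one input block to the next. *)
Definition scan : cmd :=
  Add rPtr rPtr rOne ;; Read rX rPtr ;; Add rPtr rPtr rOne ;;
  Add rPtr rPtr rX ;; Add rPtr rPtr rX ;; Defs.Sub rTodo rTodo rOne.

Definition rewind : cmd := Copy rPtr rOne ;; Copy rTodo rN.

Definition scan_write : cmd :=
  Write rTail rPtr ;; Add rTail rTail rOne ;; scan.

Definition visit_cmd (r : nat) : cmd :=
  Add rZ rSeen r ;; Read rT rZ ;;
  Ifz rT (Write rZ rOne ;; Write rTail r ;; Add rTail rTail rOne) skip.

(** With truncated subtraction, the sum of both differences is nonzero iff [rX] and [rCur] differ;
    the parity is flipped as 1 minus itself. *)
Definition read_entry_cmd : cmd :=
  Add rPtr rPtr rOne ;; Add rPtr rPtr rOne ;; Defs.Sub rLeft rLeft rOne ;;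
  Ifz rY
    (Ifz rMark skip
      (Defs.Sub rZ rX rCur ;; Add rExits rExits rZ ;;
       Defs.Sub rZ rCur rX ;; Add rExits rExits rZ))
    (Defs.Sub rPar rOne rPar).

Definition dequeue_cmd : cmd :=
  Read rCur rHead ;; Add rHead rHead rOne ;; Add rZ rTable rCur ;;
  Read rPtr rZ ;; Read rMark rPtr ;; Add rPtr rPtr rOne ;;
  Read rLeft rPtr ;; Add rPtr rPtr rOne.

Definition close_component_cmd : cmd :=
  Add rOdds rOdds rPar ;; Const rPar 0.

Definition step_cmd : cmd :=
  Ifz rLeft
    (Defs.Sub rZ rTail rHead ;;
     Ifz rZ
       (close_component_cmd ;; Defs.Sub rZ rN rRoot ;;
        Ifz rZ (Const rRun 0) (visit_cmd rRoot ;; Add rRoot rRoot rOne))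
       dequeue_cmd)
    (Read rX rPtr ;; Add rZ rPtr rOne ;; Read rY rZ ;;
     Ifz rY (visit_cmd rX) skip ;; read_entry_cmd).

(** Registers start at 0, so [rT] is the address of the first input word, the number of vertices. *)
Definition setup_cmd : cmd := Const rOne 1 ;; Read rN rT ;; rewind.

Definition setup_table_cmd : cmd :=
  Copy rTable rPtr ;; Copy rTail rPtr ;; rewind.

(** [rTail] points behind the finished table, where the flags begin; they are clear because the
    memory there is still 0. *)
Definition setup_search_cmd : cmd :=
  Copy rSeen rTail ;; Add rTail rSeen rN ;; Copy rHead rTail ;;
  Const rLeft 0 ;; Const rRoot 0 ;; Const rPar 0 ;; Const rOdds 0 ;;
  Const rExits 0 ;; Const rRun 1.

(* The first pass only finds the end of the input, where the table that the
   second pass fills begins. *)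
Definition search_cmd (final : cmd) : cmd :=
  setup_cmd ;; Loop rTodo scan ;; setup_table_cmd ;; Loop rTodo scan_write ;;
  setup_search_cmd ;; Loop rRun step_cmd ;; final.

Section Simulation.
Variables (G : graph) (H : subgraph G).
Variable adj : 'I_(nv G) -> seq ('I_(nv G) * bool).
Hypothesis adjE : adjacency_lists H adj.
Local Notation V := 'I_(nv G).
Local Notation n := (nv G).
Implicit Types (u v w : V) (s : store).

Variable words : seq nat.

Definition entries (r : seq (V * bool)) : seq nat :=
  flatten [seq [:: nat_of_ord x.1; nat_of_bool x.2] | x <- r].

Definition block v : seq nat :=
  [:: nat_of_bool (v \in sV H), size (adj v) & entries (adj v)].

Arguments entries : simpl never.
Arguments block : simpl never.

Lemma size_block v : size (block v) = 2 + size (adj v) + size (adj v).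
Proof.
rewrite /block /= !addSn; congr _.+2; rewrite /entries; elim: (adj v) => //= x r ->.
by rewrite addSn addnS.
Qed.

Definition agrees (M : nat -> nat) := forall i, i < size words -> M i = nth 0 words i.

Lemma agrees_drop M p x xs : agrees M -> prefix (x :: xs) (drop p words) ->
  [/\ M p = x, prefix xs (drop p.+1 words) & p < size words].
Proof.
move=> agM; case: (ltnP p (size words)) => [pw | /drop_oversize -> //].
rewrite (drop_nth 0 pw) prefix_cons => /andP[/eqP -> pre]; split=> //.
exact: agM.
Qed.

Lemma agrees_upd M p x : size words <= p -> agrees M -> agrees (upd M p x).
Proof. by move=> wp agM i iw; rewrite /upd ltn_eqF ?agM // (leq_trans iw). Qed.

(** [rCur] and [rMark] are tied to [a] only while entries are unread, since they are first set by a
    [dequeue]. [rPtr] is described by the input words that it points to. *)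
Record simulates (a : bfs G) s : Prop := Simulates {
  sim_N : s.1 rN = n;
  sim_One : s.1 rOne = 1;
  sim_Table : size words <= s.1 rTable;
  sim_Seen : s.1 rSeen = s.1 rTable + n;
  sim_Head : s.1 rHead = s.1 rSeen + n + taken a;
  sim_Tail : s.1 rTail = s.1 rSeen + n + size (queue a);
  sim_Root : s.1 rRoot = tried a;
  sim_Par : s.1 rPar = odd_now a;
  sim_Odds : s.1 rOdds = odds a;
  sim_Exits : (s.1 rExits != 0) = exits a;
  sim_Run : s.1 rRun = running a;
  sim_Left : s.1 rLeft = size (rest a);
  sim_Cur : 0 < size (rest a) -> s.1 rCur = cur a;
  sim_Mark : 0 < size (rest a) -> s.1 rMark = (cur a \in sV H);
  sim_rest : prefix (entries (rest a)) (drop (s.1 rPtr) words);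
  sim_words : agrees s.2;
  sim_table : forall v, prefix (block v) (drop (s.2 (s.1 rTable + v)) words);
  sim_seen : forall v, s.2 (s.1 rSeen + v) = (v \in queue a);
  sim_queue : forall i v, i < size (queue a) ->
    s.2 (s.1 rSeen + n + i) = nth v (queue a) i }.

(** The bound on [r] keeps it apart from the scratch registers [rZ] and [rT], which are overwritten
    before its last use. *)
Lemma simulates_visit a s v r : simulates a s -> r < 18 -> s.1 r = v ->
  simulates (enqueue v a) (eval (visit_cmd r) s).
Proof.
case: s => R M sim r18 rv; rewrite /=.
have nZ : (r == 18) = false by rewrite ltn_eqF.
have nT : (r == 19) = false by rewrite ltn_eqF // ltnW.
rewrite /upd /= ?nZ ?nT /=.
have := sim_seen sim v.
case: sim => /= sN sOne sTable sSeen sHead sTail sRoot sPar sOdds sExits sRun sLeft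
  sCur sMark srest swords stable sseen squeue.
rewrite /= in rv; rewrite rv => seenv.
rewrite /enqueue /visit seenv.
case: ifP => vq /=; first by split=> //; rewrite /= ?vq.
split=> //=; rewrite ?vq ?size_rcons ?sTail ?sOne ?addn1 ?addnS //.
- move=> i iw; have lv := ltn_ord v.
  by rewrite !ifN_eq ?swords //; apply/eqP; lia.
- move=> u; have lu := ltn_ord u.
  by rewrite !ifN_eq ?stable //; apply/eqP; lia.
- move=> u; have lu := ltn_ord u; have lv := ltn_ord v.
  rewrite ifN_eq; last by apply/eqP; lia.
  rewrite eqn_add2l sseen mem_rcons inE -val_eqE.
  by case: (_ == _).
move=> i u; have lv := ltn_ord v; rewrite nth_rcons !eqn_add2l.
rewrite ltnS leq_eqVlt => /predU1P[->|lti]; first by rewrite eqxx ltnn.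
rewrite lti ltn_eqF // ifN_eq; first exact: squeue.
by apply/eqP; lia.
Qed.

Lemma visit_frame s r i : i < 18 -> i != rTail -> (eval (visit_cmd r) s).1 i = s.1 i.
Proof.
case: s => R M i18 /negbTE i7; have i19 : i < 19 by apply: ltnW.
rewrite /= /upd /=; case: eqP => _ /=; by rewrite ?i7 ?ltn_eqF.
Qed.

Lemma simulates_read_entry a s x r : simulates a s -> rest a = x :: r ->
  s.1 rX = x.1 -> s.1 rY = x.2 ->
  simulates (read_entry H x r a) (eval read_entry_cmd s).
Proof.
case: s => R M [] /= sN sOne sTable sSeen sHead sTail sRoot sPar sOdds sExits sRun sLeft
  sCur sMark srest swords stable sseen squeue rE xE yE.
rewrite rE /= in sCur sMark sLeft srest.
have [_ pre1 _] := agrees_drop swords srest.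
have [_ pre2 _] := agrees_drop swords pre1.
have {}sMark := sMark isT; have {}sCur := sCur isT.
rewrite /read_entry; case: x rE xE yE srest pre1 pre2 => w b _ /= xE yE _ _ pre2.
rewrite /upd /= yE; case: b yE => yE /=.
  split; rewrite //= ?sOne ?sLeft ?addn1 ?subn1 ?sPar //=.
  - by case: (odd_now a).
  - by rewrite orbF.
rewrite sMark; case: (cur a \in sV H) => /=.
  split; rewrite //= ?sOne ?sLeft ?addn1 ?subn1 ?sPar //=.
  rewrite -sExits xE sCur -val_eqE /=.
  by case: (R 16) => [|k]; case: ltngtP => //=; lia.
split; rewrite //= ?sOne ?sLeft ?addn1 ?subn1 ?sPar //=.
by rewrite orbF.
Qed.

Lemma simulates_close_component a s : simulates a s ->
  simulates (close_component a) (eval close_component_cmd s).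
Proof.
case: s => R M [] /= *; split=> //=; rewrite /upd /=; congruence.
Qed.

Lemma simulates_next_root a s : simulates a s ->
  simulates (next_root a) (eval (Add rRoot rRoot rOne) s).
Proof.
case: s => R M [] /= *; split=> //=; rewrite /upd /= -[RHS]addn1; congruence.
Qed.

Lemma simulates_dequeue a s : simulates a s -> taken a < size (queue a) ->
  simulates (dequeue adj a) (eval dequeue_cmd s).
Proof.
case: s => R M [] /= sN sOne sTable sSeen sHead sTail sRoot sPar sOdds sExits sRun sLeft
  sCur sMark srest swords stable sseen squeue lt_q.
set v := nth (cur a) (queue a) (taken a).
have vE : M (R 6) = v by rewrite sHead; exact: squeue.
have [mE pre1 _] := agrees_drop swords (stable v).
have [szE pre2 _] := agrees_drop swords pre1.
rewrite /dequeue -/v; split; rewrite /upd //= ?sOne ?vE ?addn1 ?sHead ?addnS ?mE ?szE //.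
Qed.

Lemma simulates_ext a s R : simulates a s ->
  (forall i, i \notin [:: rX; rY; rZ; rT] -> R i = s.1 i) -> simulates a (R, s.2).
Proof.
by move=> sim eqR; case: sim => *; split; rewrite /= ?eqR.
Qed.

Lemma eval_seq c1 c2 s : eval (c1 ;; c2) s = eval c2 (eval c1 s).
Proof. by []. Qed.

Lemma eval_ifz r c1 c2 s :
  eval (Ifz r c1 c2) s = if s.1 r == 0 then eval c1 s else eval c2 s.
Proof. by []. Qed.

Lemma simulates_step a s : simulates a s ->
  simulates (step H adj a) (eval step_cmd s).
Proof.
move=> sim; rewrite /step /step_cmd eval_ifz (sim_Left sim).
case rE : (rest a) => [|x r].
  rewrite eqxx eval_seq; set s1 := eval (Defs.Sub _ _ _) s.
  have sim1 : simulates a s1.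
    apply: simulates_ext sim _ => i; rewrite !inE !negb_or => /and4P[_ _ /negbTE iZ _].
    by rewrite /= /upd iZ.
  have s1Z : s1.1 rZ = size (queue a) - taken a.
    by rewrite /s1 /= /upd /= (sim_Head sim) (sim_Tail sim) subnDl.
  rewrite eval_ifz s1Z subn_eq0; case: (leqP (size (queue a))) => [_|lt_q]; last first.
    exact: simulates_dequeue.
  rewrite eval_seq; set s2 := eval close_component_cmd s1.
  have sim2 : simulates (close_component a) s2 by exact: simulates_close_component.
  clearbody s2.
  rewrite eval_seq; set s3 := eval (Defs.Sub _ _ _) s2.
  have sim3 : simulates (close_component a) s3.
    apply: simulates_ext sim2 _ => i; rewrite !inE !negb_or => /and4P[_ _ /negbTE iZ _].
    by rewrite /= /upd iZ.
  have s3Z : s3.1 rZ = n - tried a.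
    by rewrite /s3 /= /upd /= (sim_N sim2) (sim_Root sim2).
  rewrite eval_ifz s3Z subn_eq0; case: insubP => [v lt_v vE | nlt].
    rewrite [n <= _]leqNgt lt_v eval_seq; apply: simulates_next_root.
    by apply: simulates_visit => //; rewrite (sim_Root sim3) -vE.
  rewrite leqNgt nlt; case: s3 sim3 {s3Z} => R M [] *.
  by split.
have := sim_rest sim; rewrite rE => srest.
have [xE pre1 _] := agrees_drop (sim_words sim) srest.
have [yE pre2 _] := agrees_drop (sim_words sim) pre1.
rewrite (_ : size _ == 0 = false) // eval_seq; set s1 := eval (Read _ _) s.
have sim1 : simulates a s1.
  apply: simulates_ext sim _ => i; rewrite !inE !negb_or => /and4P[/negbTE iX _ _ _].
  by rewrite /= /upd iX.
have s1X : s1.1 rX = x.1 by [].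
have s1P : s1.1 rPtr = s.1 rPtr by [].
have s1M : s1.2 = s.2 by [].
clearbody s1; rewrite eval_seq; set s2 := eval (Add _ _ _) s1.
have sim2 : simulates a s2.
  apply: simulates_ext sim1 _ => i; rewrite !inE !negb_or => /and4P[_ _ /negbTE iZ _].
  by rewrite /= /upd iZ.
have s2X : s2.1 rX = x.1 by [].
have s2Z : s2.1 rZ = (s.1 rPtr).+1.
  by rewrite /s2 /= /upd /= s1P (sim_One sim1) addn1.
have s2M : s2.2 = s.2 by [].
clearbody s2; rewrite eval_seq; set s3 := eval (Read _ _) s2.
have sim3 : simulates a s3.
  apply: simulates_ext sim2 _ => i; rewrite !inE !negb_or => /and4P[_ /negbTE iY _ _].
  by rewrite /= /upd iY.
have s3X : s3.1 rX = x.1 by [].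
have s3Y : s3.1 rY = x.2 by rewrite /s3 /= /upd /= s2Z s2M.
clearbody s3; rewrite eval_seq eval_ifz s3Y eqb0.
rewrite if_neg; case: ifP => x2; apply: simulates_read_entry => //.
- by apply: simulates_ext sim3 _ => i; rewrite !inE !negb_or /= /upd => /and4P[_ _ /negbTE-> _].
- exact: simulates_visit.
- by rewrite visit_frame.
- by rewrite visit_frame.
Qed.

(** * The two passes over the input *)

Hypothesis words_blocks : words = n :: flatten [seq block v | v <- enum V].

(** The [k] blocks left are exactly what remains of the input from [rPtr] on, so that at [k = 0] its
    end has been found. *)
Record scanning (k : nat) s : Prop := Scanning {
  scan_N : s.1 rN = n;
  scan_One : s.1 rOne = 1;
  scan_Todo : s.1 rTodo = k;
  scan_le : k <= n;
  scan_Ptr : drop (s.1 rPtr) words = flatten [seq block v | v <- drop (n - k) (enum V)];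
  scan_words : agrees s.2 }.

Lemma scanning_start s : s.1 rN = n -> s.1 rOne = 1 -> agrees s.2 ->
  scanning n (eval rewind s).
Proof.
case: s => R M /= RN ROne ag; split; rewrite //= /upd /=.
by rewrite ROne words_blocks /= subnn !drop0.
Qed.

Lemma scanning_next k s : scanning k s -> 0 < k ->
  exists v, [/\ v = n - k :> nat, prefix (block v) (drop (s.1 rPtr) words) &
    scanning k.-1 (eval scan s)].
Proof.
case=> sN sOne sTodo kn sPtr sw k0.
have lt_n : n - k < n by lia.
pose v : V := Ordinal lt_n; exists v.
have dE : drop (n - k) (enum V) = v :: drop (n - k).+1 (enum V).
  rewrite (drop_nth v) ?size_enum_ord //; congr (_ :: _).
  by apply: val_inj; rewrite /= nth_enum_ord.
have {dE}sPtr : drop (s.1 rPtr) words =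
    block v ++ flatten [seq block u | u <- drop (n - k).+1 (enum V)].
  by rewrite sPtr dE.
have pre : prefix (block v) (drop (s.1 2) words) by rewrite sPtr prefix_prefix.
split=> //.
have [_ pre1 _] := agrees_drop sw pre; have [szE _ _] := agrees_drop sw pre1.
have dropE : drop (s.1 2 + (2 + size (adj v) + size (adj v))) words =
    flatten [seq block u | u <- drop (n - k.-1) (enum V)].
  rewrite -size_block [s.1 2 + _]addnC -drop_drop sPtr drop_size_cat //.
  by have -> : (n - k).+1 = n - k.-1 by lia.
case: s sN sOne sTodo {sPtr pre pre1} sw szE dropE => R M /= sN sOne sTodo sw szE dropE.
split; rewrite //= /upd /=; [lia | lia|].
by rewrite sOne !addn1 szE -dropE; congr drop; lia.
Qed.

Lemma scanning_end s : scanning 0 s -> size words <= s.1 rPtr.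
Proof.
case=> _ _ _ _ + _; rewrite subn0 [drop n _]drop_oversize ?size_enum_ord //.
by move/(congr1 size); rewrite size_drop /=; lia.
Qed.

Definition pass1 k s := scanning k s /\ (forall i, s.2 i = nth 0 words i).

Record pass2 k s : Prop := Pass2 {
  pass2_scanning : scanning k s;
  pass2_Table : size words <= s.1 rTable;
  pass2_Tail : s.1 rTail = s.1 rTable + (n - k);
  pass2_table : forall v, v < n - k ->
    prefix (block v) (drop (s.2 (s.1 rTable + v)) words);
  pass2_zero : forall i, s.1 rTable + n <= i -> s.2 i = 0 }.

Lemma pass1_next k s : pass1 k s -> s.1 rTodo != 0 -> pass1 k.-1 (eval scan s).
Proof.
case=> sc mem_s; rewrite (scan_Todo sc) -lt0n => k0.
have [v [_ _ sc']] := scanning_next sc k0; split=> //; exact: mem_s.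
Qed.

Lemma pass2_start s : pass1 0 s -> pass2 n (eval setup_table_cmd s).
Proof.
case=> sc mem_s; have szw := scanning_end sc.
rewrite /setup_table_cmd !eval_seq.
case: s sc mem_s szw => R M sc mem_s szw; split.
- by case: sc => *; apply: scanning_start.
- by [].
- by rewrite /= /upd /= subnn addn0.
- by rewrite subnn.
move=> i; rewrite /= /upd /= => le_i; rewrite [LHS]mem_s nth_default //.
by apply: leq_trans szw (leq_trans (leq_addr _ _) le_i).
Qed.

Lemma pass2_next k s : pass2 k s -> s.1 rTodo != 0 -> pass2 k.-1 (eval scan_write s).
Proof.
case=> sc szT tail tab zero; rewrite (scan_Todo sc) -lt0n => k0.
have kn := scan_le sc.
pose s1 := eval (Add rTail rTail rOne) (eval (Write rTail rPtr) s).
have sc1 : scanning k s1.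
  case: sc => *; split=> //; apply: agrees_upd => //.
  by rewrite tail (leq_trans szT) ?leq_addr.
have [v [vE pre sc']] := scanning_next sc1 k0.
rewrite /scan_write !eval_seq -/s1.
split=> //.
- by rewrite /= /upd /= tail (scan_One sc); lia.
- move=> u lt_u; rewrite /= /upd /= tail eqn_add2l.
  case: eqP => [uE|nuE]; last by apply: tab; lia.
  by have -> : u = v by apply: val_inj; rewrite /= vE uE.
- move=> i; rewrite /= /upd /= => le_i; rewrite ifN_eq ?zero //.
  by apply/eqP; lia.
Qed.

Lemma simulates_start v s : pass2 0 s ->
  simulates (start v) (eval setup_search_cmd s).
Proof.
case=> sc szT; rewrite subn0 => tail tab zero.
case: s sc szT tail tab zero => R M [] /= sN sOne _ _ _ sw szT tail tab zero.
split; rewrite /upd //= ?sN ?tail ?addn0 //.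
- exact: prefix0s.
- by move=> u; apply: tab.
- by move=> u; rewrite zero // leq_addr.
Qed.

(** * Correctness and running time of the whole program *)

Definition found s := exists a m rs, [/\ search_inv H adj a m rs, ~~ running a & simulates a s].

(** [1000] generously covers the rounds of the three loops, linearly many by [measure_start]; since
    [0 < n], it also absorbs the constant setup. *)
Lemma search_correct (final : cmd) (J : store -> Prop) :
  0 < n -> flat final -> (forall s, found s -> J (eval final s)) ->
  triple (fun s => s = (fun=> 0, nth 0 words)) (search_cmd final)
    (cost final + 1000 * (n + ne G)) J.
Proof.
move=> n0 ff finalJ.
have tr1 : triple (fun s => s = (fun=> 0, nth 0 words)) setup_cmd (cost setup_cmd)
    (fun s => exists2 k, k <= n & pass1 k s).
  apply: triple_flat => // s ->; exists n => //; split=> //.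
  rewrite /setup_cmd !eval_seq; apply: scanning_start => //=.
  by rewrite /upd /= words_blocks.
have tr2 := @triple_loop pass1 rTodo scan n isT.
have tr3 : triple (fun s => (exists k, pass1 k s) /\ s.1 rTodo = 0) setup_table_cmd
    (cost setup_table_cmd) (fun s => exists2 k, k <= n & pass2 k s).
  apply: triple_flat => // s [[k ps] s0]; exists n => //; apply: pass2_start.
  by move: s0; rewrite (scan_Todo ps.1) => <-.
have tr4 := @triple_loop pass2 rTodo scan_write n isT.
pose I k s := exists a m rs, [/\ search_inv H adj a m rs, measure adj a = k & simulates a s].
have tr5 : triple (fun s => (exists k, pass2 k s) /\ s.1 rTodo = 0) setup_search_cmd
    (cost setup_search_cmd) (fun s => exists2 k, k <= 2 * ne G + 2 * n + 1 & I k s).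
  apply: triple_flat => // s [[k ps] s0].
  move: s0; rewrite (scan_Todo (pass2_scanning ps)) => k0; rewrite {}k0 in ps.
  pose v : V := Ordinal n0; exists (measure adj (start v)).
    by rewrite (measure_start adjE).
  by exists (start v), 0, [::]; split=> //; [exact: inv_start | exact: simulates_start].
have tr6 := @triple_loop I rRun step_cmd (2 * ne G + 2 * n + 1) isT.
have tr7 : triple (fun s => (exists k, I k s) /\ s.1 rRun = 0) final (cost final) J.
  apply: triple_flat => // s [[k [a [m [rs [Ia _ sim]]]]] run0]; apply: finalJ.
  exists a, m, rs; split=> //.
  by move: run0; rewrite (sim_Run sim); case: (running a).
have := triple_seq tr1 (triple_seq (tr2 _) (triple_seq tr3 (triple_seq (tr4 _)
  (triple_seq tr5 (triple_seq (tr6 _) tr7))))).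
move=> tr; apply: triple_weaken (tr _ _ _).
- rewrite /=; lia.
- move=> k s ps nz; exists k.-1; last exact: pass1_next.
  by move: nz; rewrite (scan_Todo ps.1); lia.
- move=> k s ps nz; exists k.-1; last exact: pass2_next.
  by move: nz; rewrite (scan_Todo (pass2_scanning ps)); lia.
move=> k s [a [m [rs [Ia <- sim]]]]; rewrite (sim_Run sim) eqb0 negbK => run_a.
exists (measure adj (step H adj a)); first exact: measure_step Ia run_a.
have [m' [rs' Ia']] := inv_step adjE Ia run_a.
by exists (step H adj a), m', rs'; split=> //; exact: simulates_step.
Qed.

End Simulation.

Lemma search_solves (final : cmd) (answer : forall G, bfs G -> bool)
    (Q : forall G, subgraph G -> Prop) :
  flat final ->
  (forall (G : graph) (H : subgraph G) adj words a s,
     simulates H adj words a s -> ((eval final s).1 rX != 0) = answer G a) ->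
  (forall (G : graph) (H : subgraph G) adj a m rs, connected H -> search_inv H adj a m rs ->
     ~~ running a -> answer G a <-> Q G H) ->
  solvable_in_linear_time connected Q.
Proof.
(* [cost final] and the last two instructions go into the factor, as a connected [H] has a vertex
   and [nv G] is positive. *)
move=> ff finalE answerP; exists (decision (search_cmd final) rX), (cost final + 1002).
move=> G H adj conH adjE; have [[x xH] _] := conH.
have n0 : 0 < nv G by apply: leq_ltn_trans (ltn_ord x).
pose w := input_words H adj.
pose J (s : store) := exists a m rs, [/\ search_inv H adj a m rs, ~~ running a &
  (s.1 rX != 0) = answer G a].
have tr := @search_correct G H adj adjE w erefl final J n0 ff.
have [|s [a [m [rs [Ia ng ->]]]] runE] := run_decision rX (tr _) erefl.
  by move=> s [a [m [rs [Ia ng sim]]]]; exists a, m, rs; split=> //; exact: finalE sim.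
exists (answer G a); split; last exact: answerP Ia ng.
by apply: run_leq runE; nia.
Qed.

(** The truncated difference is nonzero iff [rOdds] is 0. *)
Definition closed_cmd : cmd := Defs.Sub rX rOne rOdds.

(** For a nonzero count, [rX] first becomes the distance of the count from 2, and then nonzero iff
    that distance is 0. *)
Definition open_cmd : cmd :=
  Ifz rOdds (Copy rX rExits)
    (Const rY 2 ;; Defs.Sub rX rOdds rY ;; Defs.Sub rY rY rOdds ;;
     Add rX rX rY ;; Defs.Sub rX rOne rX).

Theorem theorem2 :
  solvable_in_linear_time connected S_Eulerian /\
  solvable_in_linear_time connected semi_S_Eulerian.
Proof.
split.
  apply: (@search_solves closed_cmd answer_closed) => //.
    move=> G H adj words a s sim.
    rewrite /= /upd /= (sim_One sim) (sim_Odds sim) /answer_closed.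
    by case: (odds a) => [|[]].
  by move=> G H adj a m rs; apply: answer_closedP.
apply: (@search_solves open_cmd answer_open) => //.
  move=> G H adj words a s sim; rewrite /open_cmd eval_ifz /answer_open -(sim_Exits sim).
  have := sim_Odds sim; case: (odds a) => [|[|[|k]]] oddsE;
    rewrite oddsE //= /upd /= oddsE (sim_One sim) //.
move=> G H adj a m rs; exact: answer_openP.
Qed.
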